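(* Let $\mathbb{X}$ be a Hunt process associated with a regular semi-Dirichlet form $(\mathcal{E},D[\mathcal{E}])$ on $L^2(E;m)$, let $\mathcal{P}\subset\mathcal{B}^{r,+}(E)$ be a family satisfying (P1) and (P2), and let $B$ be a Borel subset of $E$. If $(\mathbb{X},\mathcal{P},m)$ has the compactness property, then $(\mathbb{X}^B,\mathcal{P}(B),m)$ has the compactness property, where $\mathbb{X}^B$ is the part of $\mathbb{X}$ on $B$ and $\mathcal{P}(B)=\{u\in\mathcal{P}: u(x)=0 \text{ for } x\in E\setminus B\}$.
   Context: Semi-Dirichlet forms. As usual in the theory of regular forms, $E$ is a locally compact separable metric space and $m$ a positive Radon measure on $E$ with full support. Write $\mathcal{E}_\alpha(u,v)=\mathcal{E}(u,v)+\alpha(u,v)_{L^2(E;m)}$. A semi-Dirichlet form on $L^2(E;m)$ is a bilinear form $\mathcal{E}$ on a dense linear subspace $D[\mathcal{E}]\subset L^2(E;m)$ such that: (a) there is $\alpha_0\ge0$ with $\mathcal{E}_\alpha(u,u)\ge0$ for $u\in D[\mathcal{E}]$, $\alpha\ge\alpha_0$; (b) there is $K>0$ with $|\mathcal{E}(u,v)|\le K\mathcal{E}_{\alpha_0}(u,u)^{1/2}\mathcal{E}_{\alpha_0}(v,v)^{1/2}$; (c) $D[\mathcal{E}]$ with the inner product $\mathcal{E}^{(s)}_{\alpha_0}(u,v)=\frac12(\mathcal{E}_{\alpha_0}(u,v)+\mathcal{E}_{\alpha_0}(v,u))$ is a Hilbert space; (d) for $u\in D[\mathcal{E}]$, $k\ge0$: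 $u\wedge k\in D[\mathcal{E}]$ and $\mathcal{E}(u\wedge k,u\wedge k)\le\mathcal{E}(u\wedge k,u)$. It is regular if some $\mathcal{C}\subset C_0(E)\cap D[\mathcal{E}]$ ($C_0(E)$: continuous functions with compact support) is dense in $D[\mathcal{E}]$ in the $\mathcal{E}_{\alpha_0}$-norm and in $C_0(E)$ uniformly. With every regular semi-Dirichlet form there is associated a Hunt process $\mathbb{X}=(\{X_t\},\{P_x\})$ on $E$ with cemetery $\Delta$, whose transition semigroup represents the $L^2$-semigroup of the form. Notation. $\mathcal{B}^+(E)$: nonnegative numerical Borel functions; $\mathcal{B}^{r,+}(E)$: nonnegative real-valued Borel functions; functions are extended by $f(\Delta)=0$; $R_\alpha f(x)=E_x\int_0^\infty e^{-\alpha t}f(X_t)\,dt$. (P1): $f\in\mathcal{P}$, $g\in\mathcal{B}^+(E)$, $g\le f$ imply $g\in\mathcal{P}$. (P2): $\{f_n\}_{n\ge1}\subset\mathcal{P}$ implies $\sup_nf_n\in\mathcal{P}$. Part of the process. With $D_{E\setminus B}=\inf\{t\ge0: X_t\in E\setminus B\}$, put $X^B_t=X_t$ for $0\le t<D_{E\setminus B}$ and $X^B_t=\Delta$ for $t\ge D_{E\setminus B}$; $\mathbb{X}^B=(\{X^B_t\},\{P_x\}_{x\in E})$, with resolvent $f\mapsto E_x\int_0^\infty e^{-\alpha t}f(X^B_t)\,dt$. Compactness property. For a process $\mathbb{Y}$ with resolvent $\{R^{\mathbb{Y}}_\alpha\}$ and a family $\mathcal{Q}$ of nonnegative real-valued Borel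 functions, $(\mathbb{Y},\mathcal{Q},m)$ has the compactness property if for every sequence $\{u_n\}\subset\mathcal{Q}$ there exist $\Lambda\subset(0,\infty)$ with $\sup\Lambda=+\infty$ and a subsequence $(n')\subset(n)$ such that for every $\alpha\in\Lambda$ the sequence $\{R^{\mathbb{Y}}_\alpha u_{n'}\}$ converges $m$-a.e. and its limit is $m$-a.e. finite. *)

(* Defs.v *)
From HB Require Import structures.
From mathcomp Require Import all_boot all_order all_algebra.
From mathcomp Require Import all_classical all_reals all_analysis.
From mathcomp Require Import measurable_realfun metric_structure.
From mathcomp Require Import one_point_compactification.
Set Implicit Arguments.
Unset Strict Implicit.
Unset Printing Implicit Defensive.
Import Order.TTheory GRing.Theory Num.Theory.
Import numFieldNormedType.Exports.
Local Open Scope classical_set_scope.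
Local Open Scope ring_scope.

(* Library measurable types are pointed, so the state space is nonempty. *)
#[short(type="pmetricType")]
HB.structure Definition PointedMetric (K : numDomainType) :=
  { M of Metric K M & Pointed M }.

Notation borel T := (g_sigma_algebraType (@open T)).
Notation opc := one_point_compactification.

Definition separable (T : topologicalType) : Prop :=
  exists2 S : set T, countable S & dense S.

Section Forms.
Context {R : realType} {E : pmetricType R}.
Variable m : {measure set (borel E) -> \bar R}.

(* On a locally compact separable metric space a Borel measure that is finite
   on compact sets is automatically regular. *)
Definition radon_full_support : Prop :=
  (forall K : set E, compact K -> (m K < +oo)%E) /\
  (forall U : set E, open U -> U !=set0 -> (0 < m U)%E).

(* Elements of L^2(E;m) are represented by Borel functions E -> R; everything
   below is required to be compatible with m-a.e. equality. *)
Definition L2 : set (E -> R) := [set u | (u : borel E -> R) \in Lfun m 2%:E].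

Definition L2dot (u v : E -> R) : R :=
  (\int[m]_x ((u : borel E -> R) x * (v : borel E -> R) x))%R.

Definition aeeq (u v : E -> R) : Prop :=
  {ae m, forall x : borel E, u x = v x}.

Definition form_alpha (F : (E -> R) -> (E -> R) -> R) (a : R)
    (u v : E -> R) : R :=
  F u v + a * L2dot u v.

Definition form_sym (F : (E -> R) -> (E -> R) -> R) (a : R)
    (u v : E -> R) : R :=
  2^-1 * (form_alpha F a u v + form_alpha F a v u).

Record semi_Dirichlet_form (alpha0 : R) (D : set (E -> R))
    (F : (E -> R) -> (E -> R) -> R) : Prop := {
  sdf_dom_L2 : D `<=` L2 ;
  sdf_dom_ae : forall u v, D u -> L2 v -> aeeq u v -> D v ;
  sdf_ae : forall u u' v, D u -> D u' -> D v -> aeeq u u' ->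
    F u v = F u' v /\ F v u = F v u' ;
  sdf_dom0 : D (fun=> 0) ;
  sdf_dom_lin : forall (a : R) u v, D u -> D v ->
    D (fun x => a * u x + v x) ;
  sdf_dense : forall f, L2 f -> forall e : R, 0 < e ->
    exists2 u, D u & L2dot (f \- u) (f \- u) < e ;
  sdf_linl : forall (a : R) u v w, D u -> D v -> D w ->
    F (fun x => a * u x + v x) w = a * F u w + F v w ;
  sdf_linr : forall (a : R) u v w, D u -> D v -> D w ->
    F w (fun x => a * u x + v x) = a * F w u + F w v ;
  sdf_alpha0_ge0 : 0 <= alpha0 ;
  sdf_bounded_below : forall u a, D u -> alpha0 <= a ->
    0 <= form_alpha F a u u ;
  sdf_sector : exists2 K : R, 0 < K & forall u v, D u -> D v ->
    `|F u v| <= K * Num.sqrt (form_alpha F alpha0 u u)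
                  * Num.sqrt (form_alpha F alpha0 v v) ;
  sdf_definite : forall u, D u -> form_sym F alpha0 u u = 0 ->
    aeeq u (fun=> 0) ;
  sdf_complete : forall u_ : nat -> E -> R, (forall n, D (u_ n)) ->
    (forall e : R, 0 < e -> exists N : nat, forall p q : nat,
      (N <= p)%N -> (N <= q)%N ->
      form_sym F alpha0 (u_ p \- u_ q) (u_ p \- u_ q) < e) ->
    exists2 u, D u &
      (fun n => form_sym F alpha0 (u_ n \- u) (u_ n \- u)) @ \oo --> (0 : R) ;
  sdf_markov : forall u (k : R), D u -> 0 <= k ->
    let uk := fun x => Num.min (u x) k in
    D uk /\ F uk uk <= F uk u
}.

(* C_0(E): continuous functions with compact support. *)
Definition C0 : set (E -> R) :=
  [set u | continuous u /\ compact (closure [set x | u x != 0])].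

Definition regular_form (alpha0 : R) (D : set (E -> R))
    (F : (E -> R) -> (E -> R) -> R) : Prop :=
  exists C : set (E -> R),
    [/\ C `<=` C0 `&` D,
        forall u, D u -> forall e : R, 0 < e ->
          exists2 v, C v & form_alpha F alpha0 (u \- v) (u \- v) < e &
        forall u, C0 u -> forall e : R, 0 < e ->
          exists2 v, C v & forall x, `|u x - v x| < e].

(* T is the strongly continuous semigroup on L^2(E;m) determined by the form:
   its resolvent G_a f = \int_0^oo e^{-at} T_t f dt (a weak integral), a > alpha0,
   takes values in the domain and satisfies E_a(G_a f, v) = (f, v). *)
Record form_semigroup (alpha0 : R) (D : set (E -> R))
    (F : (E -> R) -> (E -> R) -> R) (T : R -> (E -> R) -> E -> R) : Prop := {
  fsg_L2 : forall t f, 0 <= t -> L2 f -> L2 (T t f) ;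
  fsg_lin : forall t (a : R) f g, 0 <= t -> L2 f -> L2 g ->
    aeeq (T t (fun x => a * f x + g x)) (fun x => a * T t f x + T t g x) ;
  fsg_bound : forall t f, 0 <= t -> L2 f ->
    L2dot (T t f) (T t f) <= expR (2 * alpha0 * t) * L2dot f f ;
  fsg0 : forall f, L2 f -> aeeq (T 0 f) f ;
  fsgD : forall s t f, 0 <= s -> 0 <= t -> L2 f ->
    aeeq (T (s + t) f) (T s (T t f)) ;
  fsg_cont : forall f, L2 f ->
    (fun t => L2dot (T t f \- f) (T t f \- f)) @ (0 : R)^'+ --> (0 : R) ;
  fsg_resolvent : forall (a : R) f, alpha0 < a -> L2 f ->
    exists u, [/\ D u,
      forall v, D v -> form_alpha F a u v = L2dot f v &
      forall g, L2 g ->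
        (\int[lebesgue_measure]_(t in `[0, +oo[)
           (expR (- (a * t)) * L2dot (T t f) g))%R = L2dot u g]
}.

End Forms.

(* The state space with cemetery is opc E, with Delta = None; Delta is isolated
   exactly when E is compact. A family of maps X is only used at times t >= 0. *)
Section Processes.
Context {R : realType} {E : pmetricType R} {d : measure_display}
        {Omega : measurableType d}.
Implicit Types (X Y : R -> Omega -> opc E) (P : opc E -> probability Omega R).

Definition ext0 {V : nmodType} (f : E -> V) (y : opc E) : V :=
  if y is Some x then f x else 0.

(* X_s for s in [0, +oo], with X_{+oo} = Delta. *)
Definition at_time X (s : \bar R) (w : Omega) : opc E :=
  if s is r%:E then X r w else None.

Definition lifetime X (w : Omega) : \bar R :=
  ereal_inf [set t%:E | t in [set t : R | 0 <= t /\ X t w = None]].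

(* F^0_t = sigma(X_s, s <= t), t in [0, +oo]. *)
Definition natural_filtration X (t : \bar R) : set (set Omega) :=
  <<s [set A | exists s : R, [/\ 0 <= s, (s%:E <= t)%E &
         exists2 B : set (borel (opc E)), measurable B & A = X s @^-1` B]] >>.

(* N is P_mu-negligible, where P_mu = \int P_x mu(dx) on F^0_oo. *)
Definition law_null X P (mu : probability (borel (opc E)) R) (N : set Omega)
    : Prop :=
  exists2 M, natural_filtration X +oo M &
    N `<=` M /\ (\int[mu]_x P x M = 0)%E.

(* F_t = \bigcap_mu F^mu_t, where F^mu_t is F^0_t augmented by the
   P_mu-negligible sets. *)
Definition augmented_filtration X P (t : \bar R) : set (set Omega) :=
  [set A | forall mu : probability (borel (opc E)) R,
     exists2 A', natural_filtration X t A' &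
       law_null X P mu ((A `\` A') `|` (A' `\` A))].

(* Q is P_mu; as every measurable set is sandwiched between F^0_oo-measurable
   ones up to P_mu-null sets, Q is determined by its values on F^0_oo. *)
Definition is_law X P (mu : probability (borel (opc E)) R)
    (Q : probability Omega R) : Prop :=
  forall A, natural_filtration X +oo A -> (Q A = \int[mu]_x P x A)%E.

Definition stopping_time X P (s : Omega -> \bar R) : Prop :=
  (forall w, (0 <= s w)%E) /\
  (forall t : R, 0 <= t ->
     augmented_filtration X P t%:E [set w | (s w <= t%:E)%E]).

Definition stopped_sigma_field X P (s : Omega -> \bar R) : set (set Omega) :=
  [set A | augmented_filtration X P +oo A /\
     forall t : R, 0 <= t ->
       augmented_filtration X P t%:E (A `&` [set w | (s w <= t%:E)%E])].

Record Hunt_process X P : Prop := {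
  hunt_sigma_field : (measurable : set (set Omega)) =
    augmented_filtration X P +oo ;
  hunt_kernel : forall (t : R) (B : set (borel (opc E))), 0 <= t ->
    measurable B ->
    measurable_fun [set: borel (opc E)]
      (fun x : borel (opc E) => P x (X t @^-1` B)) ;
  hunt_normal : forall x, P x [set w | X 0 w = x] = 1%E ;
  hunt_cemetery : forall t, 0 <= t -> P None [set w | X t w = None] = 1%E ;
  hunt_lifetime : forall w t, 0 <= t -> (lifetime X w <= t%:E)%E ->
    X t w = None ;
  hunt_shift : exists theta : R -> Omega -> Omega, forall s t w,
    0 <= s -> 0 <= t -> X s (theta t w) = X (s + t) w ;
  hunt_right_continuous : forall w t, 0 <= t -> X ^~ w @ t^'+ --> X t w ;
  hunt_left_limit : forall w t, 0 < t ->
    exists l : opc E, X ^~ w @ t^'- --> l ;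
  hunt_filtration : forall t : R, 0 <= t ->
    augmented_filtration X P t%:E =
      \bigcap_(s in [set s : R | t < s]) augmented_filtration X P s%:E ;
  hunt_strong_markov : forall mu Q s (t : R) A (B : set (borel (opc E))),
    is_law X P mu Q -> stopping_time X P s -> 0 <= t ->
    stopped_sigma_field X P s A -> measurable B ->
    Q (A `&` [set w | B (at_time X (s w + t%:E)%E w)]) =
      (\int[Q]_(w in A) P (at_time X (s w) w) (X t @^-1` B))%E ;
  hunt_quasi_left_continuous : forall mu Q (s_ : nat -> Omega -> \bar R) s,
    is_law X P mu Q -> (forall n, stopping_time X P (s_ n)) ->
    stopping_time X P s ->
    (forall w, {homo s_ ^~ w : i j / (i <= j)%N >-> (i <= j)%E}) ->
    (forall w, s_ ^~ w @ \oo --> s w) ->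
    {ae Q, forall w, (s w < +oo)%E ->
       (fun n => at_time X (s_ n w) w) @ \oo --> at_time X (s w) w}
}.

Definition associated (m : {measure set (borel E) -> \bar R}) (alpha0 : R)
    (D : set (E -> R)) (F : (E -> R) -> (E -> R) -> R) X P : Prop :=
  exists T, form_semigroup m alpha0 D F T /\
    forall (t : R) (f : E -> R), 0 <= t -> L2 m f ->
      {ae m, forall x : borel E,
         (\int[P (Some x)]_w (ext0 f (X t w))%:E)%E = (T t f x)%:E}.

Definition resolvent P Y (a : R) (f : E -> \bar R) (x : E) : \bar R :=
  (\int[P (Some x)]_w \int[lebesgue_measure]_(t in `[0%R, +oo[)
     ((expR (- (a * t)))%:E * ext0 f (Y t w)))%E.

(* The debut of the complement of B in E; visits to Delta do not count. *)
Definition debut_out X (B : set E) (w : Omega) : \bar R :=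
  ereal_inf [set t%:E | t in
    [set t : R | 0 <= t /\ exists2 x, ~ B x & X t w = Some x]].

Definition part_process X (B : set E) (t : R) (w : Omega) : opc E :=
  if (t%:E < debut_out X B w)%E then X t w else None.

Definition compactness_property (m : {measure set (borel E) -> \bar R}) P Y
    (Q : set (E -> \bar R)) : Prop :=
  forall u_ : nat -> E -> \bar R, (forall n, Q (u_ n)) ->
  exists (L : set R) (phi : nat -> nat),
    [/\ L `<=` [set a | 0 < a],
        ereal_sup [set a%:E | a in L] = +oo%E,
        {homo phi : i j / (i < j)%N} &
        forall a, L a ->
          {ae m, forall x : borel E,
             cvgn (fun n => resolvent P Y a (u_ (phi n)) x)} /\
          {ae m, forall x : borel E,
             limn (fun n => resolvent P Y a (u_ (phi n)) x) \is a fin_num}].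

End Processes.

Section Families.
Context {R : realType} {E : pmetricType R}.
Implicit Types Pf : set (E -> \bar R).

(* B^+(E) and B^{r,+}(E). *)
Definition Borel_nneg : set (E -> \bar R) :=
  [set f | measurable_fun [set: borel E] (f : borel E -> \bar R) /\
           forall x, (0 <= f x)%E].

Definition Borel_real_nneg : set (E -> \bar R) :=
  [set f | Borel_nneg f /\ forall x, f x \is a fin_num].

Definition P1 Pf : Prop :=
  forall f g, Pf f -> Borel_nneg g -> (forall x, (g x <= f x)%E) -> Pf g.

Definition P2 Pf : Prop :=
  forall f_ : nat -> E -> \bar R, (forall n, Pf (f_ n)) ->
    Pf (fun x => ereal_sup (range (f_ ^~ x))).

Definition vanishing_off Pf (B : set E) : set (E -> \bar R) :=
  [set u | Pf u /\ forall x, ~ B x -> u x = 0%E].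

End Families.

(* Main.v *)
Require Import Defs.
From HB Require Import structures.
From mathcomp Require Import all_boot all_order all_algebra.
From mathcomp Require Import all_classical all_reals all_analysis.
From mathcomp Require Import measurable_realfun metric_structure.
From mathcomp Require Import one_point_compactification lra.
Set Implicit Arguments.
Unset Strict Implicit.
Unset Printing Implicit Defensive.
Import Order.TTheory GRing.Theory Num.Theory.
Import numFieldNormedType.Exports.
Local Open Scope classical_set_scope.
Local Open Scope ring_scope.

(** Let g be the supremum of the sequence u_n, which belongs to the family, and let
    N be an m-null Borel set off which h_n = R_a u_n converges. Call a point y good
    if R_a g(y) is finite and R_a 1_N(y) = 0. Since the semigroup does not charge
    m-null sets, m-almost every point is good; and at a good point h_n converges,
    because E_y[e^(-as) h_n(X_s)] differs from h_n(y) by at most the E_y-mean of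
    the integral of e^(-at) g(X_t) over [0, s], while X_s avoids N almost surely
    for almost every s.

    Let tau be the debut of the complement of B. Dynkin's formula reads
    R^B_a u_n(x) = h_n(x) - E_x[e^(-a tau) h_n(X_tau)]. As R_a g and R_a 1_N are
    a-excessive, X_tau is P_x-almost surely a good point when x is good, and the
    last term converges by dominated convergence with e^(-a tau) R_a g(X_tau).

    Dynkin's formula requires tau to be a stopping time, which rests on the
    universal measurability of projections of Borel sets. *)

(** * Souslin sets and projections *)

(** The law of X_tau under [P x] need not be absolutely continuous with respect to [m], so
    convergence [m]-almost everywhere cannot simply be evaluated at X_tau. Goodness is expressed
    through resolvents of nonnegative functions, and the part of such an integral after a stopping
    time is at most the whole: this is what carries goodness from x to X_tau.

    Finiteness of the resolvent of g comes from the compactness property itself, applied to the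
    constant sequence g. It is used at one index b, and the index set is then cut to the indices at
    least b, along the subsequence already chosen for u_n.

    Being a stopping time refers to the null sets of every P_mu. Before P_mu can be treated as a
    measure, [P x A] must be measurable in x for all A in F^0_oo, whereas the axioms give this for
    one-time events only; the Markov property extends it. Likewise the strong Markov axiom concerns
    one later time and one event of the stopped field, and has to be turned into an identity between
    discounted resolvents. *)

Section Souslin.
Context {T : Type}.
Implicit Types (G : set (set T)) (C : nat -> (nat -> nat) -> set T).

(* The Souslin operation in a form that is stable under countable unions and
   intersections: [C k f] may depend on an initial segment of [f] whose length
   depends on [k] only. *)
Definition finitely_determined {U} (C : nat -> (nat -> nat) -> U) : Prop :=
  forall k, exists N, forall f g : nat -> nat,
    (forall i, (i < N)%N -> f i = g i) -> C k f = C k g.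

Definition souslin_kernel C : set T := [set x | exists f, forall k, C k f x].

Definition souslin G : set (set T) :=
  [set H | exists C, [/\ forall k f, G (C k f), finitely_determined C &
                        H = souslin_kernel C]].

Definition nat_unpair (k : nat) : nat * nat := odflt (0, 0)%N (unpickle k).

Lemma nat_unpairK (p : nat * nat) : nat_unpair (pickle p) = p.
Proof. by rewrite /nat_unpair pickleK. Qed.

Lemma souslin_sub G : G `<=` souslin G.
Proof.
move=> H GH; exists (fun _ _ => H); split => //; first by move=> k; exists 0%N.
by apply/seteqP; split => [x Hx|x [_ /(_ 0%N)]//]; exists id.
Qed.

(** A single branch [f] carries one branch for each [i], namely [j |-> f (pickle (i, j))], and the
    index [k] codes a set together with one of its conditions. *)
Lemma souslin_bigcap G (H : nat -> set T) :
  (forall i, souslin G (H i)) -> souslin G (\bigcap_i H i).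
Proof.
move=> /choice[C HC].
exists (fun k f => C (nat_unpair k).1 (nat_unpair k).2
  (fun j => f (pickle ((nat_unpair k).1, j)))); split.
- by move=> k f; have [+ _ _] := HC (nat_unpair k).1; exact.
- move=> k; have [_ /(_ (nat_unpair k).2)[N hN] _] := HC (nat_unpair k).1.
  exists (\max_(j < N) (pickle ((nat_unpair k).1, j : nat))).+1 => f g fg.
  apply: hN => j jN; apply: fg; rewrite ltnS.
  exact: (@leq_bigmax _ (fun j : 'I_N => pickle ((nat_unpair k).1, j : nat))
    (Ordinal jN)).
- apply/seteqP; split => [x Hx|x [f hf] i _].
    have /choice[f hf] : forall i, exists f, forall k, C i k f x.
      by move=> i; have [_ _ HE] := HC i; have := Hx i I; rewrite HE.
    exists (fun c => f (nat_unpair c).1 (nat_unpair c).2) => k.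
    by under eq_fun do rewrite nat_unpairK; exact: hf.
  have [_ _ ->] := HC i; exists (fun j => f (pickle (i, j))) => n.
  by have := hf (pickle (i, n)); rewrite nat_unpairK.
Qed.

(** The entry [f 0] selects the set and the later entries form its branch. Conditions that belong to
    other sets become [setT], whence the hypothesis on [G]. *)
Lemma souslin_bigcup G (H : nat -> set T) : G setT ->
  (forall i, souslin G (H i)) -> souslin G (\bigcup_i H i).
Proof.
move=> GT /choice[C HC].
exists (fun k f => if (nat_unpair k).1 == f 0%N then
  C (nat_unpair k).1 (nat_unpair k).2 (fun j => f j.+1) else setT); split.
- move=> k f; case: ifP => // _.
  by have [+ _ _] := HC (nat_unpair k).1; exact.
- move=> k; have [_ /(_ (nat_unpair k).2)[N hN] _] := HC (nat_unpair k).1.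
  exists N.+1 => f g fg; rewrite (fg 0%N)//; case: ifP => // _.
  by apply: hN => j jN; exact: fg.
- apply/seteqP; split => [x [i _]|x [f hf]].
    have [_ _ ->] := HC i => -[f hf].
    exists (fun j => if j is j'.+1 then f j' else i) => k.
    by case: ifP => //= /eqP ->; exact: hf.
  exists (f 0%N) => //; have [_ _ ->] := HC (f 0%N).
  exists (fun j => f j.+1) => n.
  by have := hf (pickle (f 0%N, n)); rewrite nat_unpairK eqxx.
Qed.

(* The sets that are Souslin together with their complement form a
   sigma-algebra, so it suffices to treat the complements of generators. *)
Lemma sub_souslin G (F : set (set T)) : G setT -> G set0 ->
  (forall A, F A -> souslin G A /\ souslin G (~` A)) -> <<s F >> `<=` souslin G.
Proof.
move=> GT G0 hF.
pose S := [set A | souslin G A /\ souslin G (~` A)].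
suff : <<s F >> `<=` S by move=> h A /h[].
apply: smallest_sub => //; split.
- by split; [|rewrite setC0]; exact: souslin_sub.
- by move=> A [sA sCA]; rewrite setTD; split => //; rewrite setCK.
- move=> A hA; split; first by apply: souslin_bigcup => // i; case: (hA i).
  by rewrite setC_bigcup; apply: souslin_bigcap => i; case: (hA i).
Qed.

End Souslin.

(** * Koenig's lemma for branches bounded by a fixed sequence *)

Section konig.

Definition below (h f : nat -> nat) (n : nat) : Prop :=
  forall i, (i < n)%N -> (f i <= h i)%N.

Lemma konig (h : nat -> nat) (Q : nat -> (nat -> nat) -> Prop) :
  (forall n f g, (forall i, (i < n)%N -> f i = g i) -> Q n f -> Q n g) ->
  (forall n f, Q n.+1 f -> Q n f) ->
  (forall n, exists f, below h f n /\ Q n f) ->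
  exists f, forall n, Q n f.
Proof.
move=> Qloc Qdec Qex.
have Qle n p f : (n <= p)%N -> Q p f -> Q n f.
  by move=> /subnK <-; elim: (p - n)%N => // k ih /Qdec.
(* The first [n] entries of [f] extend to bounded solutions at every level [p]; a branch is built
   one entry at a time while keeping this. *)
pose ok n (f : nat -> nat) := forall p, exists g,
  [/\ (forall i, (i < n)%N -> g i = f i), below h g p & Q p g].
have ok0 : ok 0%N id by move=> p; have [g [? ?]] := Qex p; exists g.
have okS n f : ok n f -> exists v, ok n.+1 (fun i => if i == n then v else f i).
  move=> okn; apply: contrapT => /forallNP nok.
  have /choice[p hp] : forall v, exists p, forall g, ~
      [/\ (forall i, (i < n.+1)%N -> g i = if i == n then v else f i),
          below h g p & Q p g].
    by move=> v; have /existsNP[p /forallNP hp] := nok v; exists p.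
  (* Only the values up to [h n] are candidates, so one level [M] refutes them all. A solution at
     level [M] still has an entry at [n], as [M] exceeds [n], and that entry is one of the refuted
     values. *)
  pose M := maxn n.+1 (\max_(v < (h n).+1) p v).
  have [g [gf gh gQ]] := okn M.
  have gn : (g n < (h n).+1)%N by rewrite ltnS gh// leq_max ltnSn.
  have pM : (p (g n) <= M)%N.
    rewrite leq_max; apply/orP; right.
    exact: (@leq_bigmax _ (fun v : 'I_(h n).+1 => p v) (Ordinal gn)).
  apply: (hp (g n) g); split.
  - move=> i; rewrite ltnS leq_eqVlt => /predU1P[->|iltn]; first by rewrite eqxx.
    by rewrite (ltn_eqF iltn) gf.
  - by move=> i ip; apply: gh; exact: leq_trans ip pM.
  - exact: Qle pM gQ.
have /choice[nxt hnxt] : forall nf : nat * (nat -> nat), exists v,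
    ok nf.1 nf.2 -> ok nf.1.+1 (fun i => if i == nf.1 then v else nf.2 i).
  move=> [n f]; have [/okS[v hv]|] := pselect (ok n f); first by exists v.
  by move=> nok; exists 0%N.
pose F := fix F n := if n is n'.+1 then
  (fun i => if i == n' then nxt (n', F n') else F n' i) else (id : nat -> nat).
have okF n : ok n (F n).
  by elim: n => //= n ih; exact: (hnxt (n, F n) ih).
have FS n i : (i < n)%N -> F n i = F i.+1 i.
  elim: n => // n ih; rewrite ltnS leq_eqVlt => /predU1P[->//|iltn].
  by rewrite /= (ltn_eqF iltn) ih//= eqxx.
exists (fun i => F i.+1 i) => n.
have [g [gF _ gQ]] := okF n n.
by apply: Qloc gQ => i iltn; rewrite gF// FS.
Qed.

End konig.

(** * Souslin sets are measurable up to null sets *)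

Section Lusin.
Context {d : measure_display} {T : measurableType d} {R : realType}.
Variable mu : {finite_measure set T -> \bar R}.
Local Open Scope ereal_scope.

(** The measure of such an [M] is the outer measure of [A]; it is attained by intersecting a
    minimizing sequence. *)
Lemma measurable_hull (A : set T) : exists M, [/\ measurable M, A `<=` M &
  forall M', measurable M' -> A `<=` M' -> mu M <= mu M'].
Proof.
pose V := [set mu M | M in [set M | measurable M /\ A `<=` M]].
have infV : ereal_inf V \is a fin_num.
  rewrite ge0_fin_numE; last by apply: le_ereal_inf_tmp => _ [M _ <-].
  apply: le_lt_trans (fin_num_fun_lty (fin_num_measure mu)).
  by apply: ereal_inf_lbound; exists setT.
have /choice[M hM] : forall n : nat, exists M, [/\ measurable M, A `<=` M &
    mu M < ereal_inf V + n.+1%:R^-1%:E].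
  move=> n; have e0 : (0 < (n.+1%:R^-1 : R))%R by rewrite invr_gt0.
  have [_ [M [mM AM] <-] h] := lb_ereal_inf_adherent e0 infV.
  by exists M.
have mM : measurable (\bigcap_n M n) by apply: bigcapT_measurable => n; case: (hM n).
exists (\bigcap_n M n); split => //.
  by move=> x Ax n _; have [_ + _] := hM n; exact.
move=> M' mM' AM'; apply: (@le_trans _ _ (ereal_inf V)); last first.
  by apply: ereal_inf_lbound; exists M'.
apply/lee_addgt0Pr => e e0.
have [n ne] : exists n : nat, (n.+1%:R^-1 < e)%R.
  have [n _ hn] := near_infty_natSinv_lt (PosNum e0).
  by exists n; exact: hn n (leqnn n).
have [mMn _ h] := hM n.
apply: (@le_trans _ _ (mu (M n))).
  by apply: le_measure; rewrite ?inE//; exact: bigcap_inf.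
by apply: (le_trans (ltW h)); rewrite leeD2l// lee_fin ltW.
Qed.

Let hull A := projT1 (cid (measurable_hull A)).
Let hullP A := projT2 (cid (measurable_hull A)).

(** The chosen hulls need not increase. The intersections of all later hulls do, and the [n]-th one
    still contains [A n] and has measure at most that of [hull (A n)]. *)
Let hull_sup (A : nat -> set T) c : nondecreasing_seq A ->
  c < mu (hull (\bigcup_n A n)) -> exists n, c < mu (hull (A n)).
Proof.
move=> ndA cA; apply: contrapT => /forallNP nA.
have leA n : mu (hull (A n)) <= c by rewrite leNgt; apply/negP/nA.
pose M n := \bigcap_(k >= n) hull (A k).
have mM n : measurable (M n).
  by apply: bigcap_measurable => [|k _]; [exists n => /=|case: (hullP (A k))].
have ndM : nondecreasing_seq M.
  by move=> n p np; apply/subsetPset => x Mx k /= pk; apply: Mx; exact: leq_trans pk.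
have AM n : A n `<=` M n.
  move=> x Ax k /= nk; have [_ h _] := hullP (A k); apply: h.
  by move/subsetPset: (ndA _ _ nk); exact.
have mUM : measurable (\bigcup_n M n) by exact: bigcupT_measurable.
have Mc n : mu (M n) <= c.
  apply: le_trans (leA n); apply: le_measure; rewrite ?inE//.
    by case: (hullP (A n)).
  by apply: bigcap_inf => /=.
have cvgM := nondecreasing_cvg_mu (mu := mu) mM mUM ndM.
have : mu (\bigcup_n M n) <= c.
  rewrite -(cvg_lim _ cvgM)//; apply: lime_le; first by apply/cvg_ex; eexists; exact: cvgM.
  by apply: nearW => n; exact: Mc.
apply/negP; rewrite -ltNge; apply: lt_le_trans cA _.
have [_ _ h] := hullP (\bigcup_n A n); apply: h => //.
by apply: subset_bigcup => n _; exact: AM.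
Qed.

(* The outer measure is continuous from below, so the branches can be bounded
   one level at a time by some [h] without losing measure; by Koenig's lemma the
   branches below [h] form a compact set, which gives a measurable subset. *)
Lemma souslin_inner_regular (H : set T) c : souslin measurable H ->
  c < mu (hull H) -> exists2 K, measurable K & K `<=` H /\ c <= mu K.
Proof.
move=> [C [mC /choice[N hN] HE]] cH.
pose S h n := [set x | exists f, below h f n /\ forall k, C k f x].
pose upd h n v := fun i : nat => if i == n then v else h i : nat.
have belowE h h' f n : (forall i, (i < n)%N -> h i = h' i) ->
  below h f n -> below h' f n by move=> hh' b i iltn; rewrite -hh'// b.
(* Bounding the entry [n] by [v] exhausts [S h n] increasingly as [v] grows, so some bound keeps the
   outer measure above [c]. *)
have stepS n h : c < mu (hull (S h n)) ->
    exists v, c < mu (hull (S (upd h n v) n.+1)).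
  have -> : S h n = \bigcup_v S (upd h n v) n.+1.
    apply/seteqP; split => [x [f [fh fC]]|x [v _ [f [fh fC]]]].
      exists (f n) => //; exists f; split => // i; rewrite /upd ltnS leq_eqVlt.
      by case: eqP => [->//|_ /=]; exact: fh.
    exists f; split => // i iltn; have := fh i (ltnW iltn).
    by rewrite /upd (ltn_eqF iltn).
  apply: hull_sup => v w vw; apply/subsetPset => x [f [fh fC]].
  exists f; split => // i iltn; have := fh i iltn; rewrite /upd.
  by case: eqP => // _ /leq_trans; exact.
have /choice[nxt hnxt] : forall nf : nat * (nat -> nat), exists v,
    c < mu (hull (S nf.2 nf.1)) -> c < mu (hull (S (upd nf.2 nf.1 v) nf.1.+1)).
  move=> [n h]; have [/stepS[v hv]|] := pselect (c < mu (hull (S h n))).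
    by exists v.
  by move=> nok; exists 0%N.
pose F := fix F n := if n is n'.+1 then upd (F n') n' (nxt (n', F n'))
  else (id : nat -> nat).
have okF n : c < mu (hull (S (F n) n)).
  elim: n => [|n ih]; last exact: (hnxt (n, F n) ih).
  suff -> : S (F 0%N) 0%N = H by [].
  rewrite HE; apply/seteqP; split => [x [f [_ fC]]|x [f fC]]; first by exists f.
  by exists f; split.
have FS n i : (i < n)%N -> F n i = F i.+1 i.
  elim: n => // n ih; rewrite ltnS leq_eqVlt => /predU1P[->//|iltn].
  by rewrite /= /upd (ltn_eqF iltn) ih//= eqxx.
pose h i := F i.+1 i.
(* The restriction [N k <= n] retains only conditions decided by the first [n] entries of [f]; every
   condition is retained for large [n]. *)
pose Q x n f := forall k, (k < n)%N -> (N k <= n)%N -> C k f x.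
have Qloc x n f g : (forall i, (i < n)%N -> f i = g i) -> Q x n f -> Q x n g.
  move=> fg fQ k kn Nn; rewrite -(hN k f g); first exact: fQ.
  by move=> i iN; apply: fg; exact: leq_trans iN Nn.
have Qdec x n f : Q x n.+1 f -> Q x n f.
  by move=> fQ k kn Nn; apply: fQ; exact: leqW.
pose K n := [set x | exists f, below h f n /\ Q x n f].
(* Membership in [K n] is witnessed by a finite sequence, and these are countably many. *)
have mK n : measurable (K n).
  have [dec decK] : exists dec : nat -> seq nat, forall s, dec (pickle s) = s.
    by exists (fun j => odflt [::] (unpickle j)) => s; rewrite pickleK.
  have -> : K n = \bigcup_j (let f := nth 0%N (dec j) in
      [set x | below h f n /\ Q x n f]).
    apply/seteqP; split => [x [f [fh fQ]]|x [j _ /= xj]]; last by eexists; exact: xj.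
    exists (pickle (mkseq f n)); first by []; rewrite decK; split.
      by move=> i iltn; rewrite nth_mkseq// fh.
    by apply: Qloc fQ => i iltn; rewrite nth_mkseq.
  apply: bigcupT_measurable => j /=; set f := nth _ _.
  have [bf|nbf] := pselect (below h f n); last first.
    by rewrite (_ : [set _ | _] = set0)//; apply/seteqP; split => // x [].
  have -> : [set x | below h f n /\ Q x n f] =
      \bigcap_k (if (k < n)%N && (N k <= n)%N then C k f else setT).
    apply/seteqP; split => [x [_ fQ] k _|x fQ].
      by case: ifP => // /andP[kn Nn]; exact: fQ.
    by split => // k kn Nn; have := fQ k I; rewrite kn Nn.
  by apply: bigcapT_measurable => k; case: ifP => // _; exact: mC.
have ck n : c < mu (K n).
  apply: lt_le_trans (okF n) _.
  have [_ _] := hullP (S (F n) n); apply => // x [f [fh fC]].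
  by exists f; split => [|k _ _//]; apply: belowE fh => i; exact: FS.
have mcapK : measurable (\bigcap_n K n) by exact: bigcapT_measurable.
exists (\bigcap_n K n) => //; split.
  move=> x Kx; rewrite HE.
  have [f hf] := konig (Qloc x) (Qdec x) (fun n => Kx n I).
  by exists f => k; apply: (hf (maxn k.+1 (N k)) k); rewrite leq_max ?ltnSn ?leqnn ?orbT.
have niK : nonincreasing_seq K.
  move=> n p np; apply/subsetPset => x; rewrite -(subnK np).
  elim: (p - n)%N => // q ih [f [fh fQ]]; apply: ih.
  by exists f; split; [move=> i iq; apply: fh; exact: leqW|exact: Qdec].
have K0 : mu (K 0%N) < +oo by rewrite ltey_eq fin_num_measure.
have cvgK := nonincreasing_cvg_mu
  K0 mK mcapK niK.
rewrite -(cvg_lim _ cvgK)//; apply: lime_ge; first by apply/cvg_ex; eexists; exact: cvgK.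
by apply: nearW => n; exact/ltW/ck.
Qed.

(** The outer set is the hull. The inner one is a union of sets from inner regularity, with bounds
    increasing to the measure of the hull, which is finite. *)
Lemma souslin_measurable (H : set T) : souslin measurable H ->
  exists K M, [/\ measurable K, measurable M, K `<=` H, H `<=` M &
                 mu (M `\` K) = 0].
Proof.
move=> sH; have [mM HM _] := hullP H.
have fM : mu (hull H) \is a fin_num by exact: fin_num_measure.
have /choice[K hK] : forall n : nat, exists K, [/\ measurable K, K `<=` H &
    mu (hull H) - n.+1%:R^-1%:E <= mu K].
  move=> n; have [|K mK [KH cK]] :=
    @souslin_inner_regular H (mu (hull H) - n.+1%:R^-1%:E) sH.
    by rewrite lteBlDr// lteDl// lte_fin invr_gt0.
  by exists K.
have mK : measurable (\bigcup_n K n) by apply: bigcupT_measurable => n; case: (hK n).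
have KH : \bigcup_n K n `<=` H by apply: bigcup_sub => n _; case: (hK n).
exists (\bigcup_n K n), (hull H); split => //.
have KM : \bigcup_n K n `<=` hull H by exact: subset_trans KH HM.
rewrite measureD//; last by rewrite ltey_eq fM.
rewrite setIidr// -(subee fM); congr (_ - _).
apply/eqP; rewrite eq_le; apply/andP; split.
  by apply: le_measure; rewrite ?inE.
apply/lee_addgt0Pr => e e0.
have [n ne] : exists n : nat, (n.+1%:R^-1 < e)%R.
  have [n _ hn] := near_infty_natSinv_lt (PosNum e0).
  by exists n; exact: hn n (leqnn n).
have [mKn _ h] := hK n.
move: h; rewrite leeBlDr// => h; apply: (le_trans h).
apply: leeD; last by rewrite lee_fin ltW.
by apply: le_measure; rewrite ?inE//; exact: bigcup_sup.
Qed.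

End Lusin.

(** * Projection along the time axis *)

Section projection.
Context {d : measure_display} {T : measurableType d} {R : realType}.

(** Closed sides, rather than Borel ones, allow a compactness argument in the time variable; Borel
    sides are recovered by the Souslin operation. *)
Definition closed_rectangles : set (set (R * T)) :=
  [set A `*` B | A in closed & B in measurable].

Lemma measurable_souslin (H : set (measurableTypeR R * T)) :
  measurable H -> souslin closed_rectangles H.
Proof.
have GT : closed_rectangles setT.
  by exists setT; [exact: closedT|exists setT => //; rewrite setXTT].
have G0 : closed_rectangles set0.
  by exists set0; [exact: closed0|exists set0 => //; rewrite setX0].
rewrite measurable_prod_measurableType.
pose S : set (set (R * T)) :=
  [set A | souslin closed_rectangles A /\ souslin closed_rectangles (~` A)].
have SU (A : nat -> set (R * T)) : (forall n, S (A n)) -> S (\bigcup_n A n).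
  move=> hA; split; first by apply: souslin_bigcup => // i; case: (hA i).
  by rewrite setC_bigcup; apply: souslin_bigcap => i; case: (hA i).
have SC A : S A -> S (~` A) by move=> [? ?]; split => //; rewrite setCK.
have closedS (A : set R) : closed A -> closed_rectangles (A `*` setT).
  by move=> cA; exists A => //; exists setT.
have S1 : forall A : set (measurableTypeR R), measurable A -> S (A `*` setT).
  rewrite RGenCInfty.measurableE; apply: smallest_sub.
    split.
    - by rewrite set0X; split; [|rewrite setC0]; exact: souslin_sub.
    - move=> A SA /=; rewrite setTD.
      rewrite (_ : ~` A `*` setT = ~` (A `*` setT)); first exact: SC.
      by apply/seteqP; split => -[x y] /=; tauto.
    - move=> A hA; rewrite (_ : _ `*` _ = \bigcup_n (A n `*` setT)); first exact: SU.
      by apply/seteqP; split => -[x y] /= => [[[n _ ?] _]|[n _ [? _]]];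
        [exists n|split => //; exists n].
  move=> _ [x ->]; split.
    apply: souslin_sub; apply: closedS; exact: interval_closed.
  (* The complement of the generator is an open half-line, hence a countable union of closed
     ones. *)
  rewrite (_ : ~` _ = \bigcup_n (`]-oo, (x - n.+1%:R^-1)] `*` setT)).
    apply: souslin_bigcup => // n; apply: souslin_sub; apply: closedS.
    exact: interval_closed.
  apply/seteqP; split => -[y w] /=.
    move=> /not_andP[|//]; rewrite in_itv /= andbT => /negP; rewrite -ltNge => yx.
    have xy0 : 0 < x - y by rewrite subr_gt0.
    have [n _ hn] := near_infty_natSinv_lt (PosNum xy0).
    exists n => //=; split => //; rewrite in_itv /= lerBrDr -lerBrDl.
    exact/ltW/(hn n (leqnn n)).
  move=> [n _ [/=]]; rewrite in_itv /= => yx _ [+ _]; rewrite in_itv /= andbT => xy.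
  have := le_trans xy yx; rewrite lerBrDr gerDl; apply/negP; rewrite -ltNge.
  by rewrite invr_gt0.
apply: sub_souslin => // _ [A mA [B mB <-]].
have mAB : closed_rectangles (setT `*` B) by exists setT => //; exists B.
have mABC : closed_rectangles (setT `*` ~` B).
  by exists setT => //; exists (~` B) => //; exact: measurableC.
have -> : A `*` B = ~` (\bigcup_n (if n is 0%N then ~` (A `*` setT) else
    ~` (setT `*` B))).
  apply/seteqP; split => -[x y] /=.
    by move=> [Ax By] [[|n] _] /=; tauto.
  by move=> h; split; apply: contrapT => h'; apply: h; [exists 0%N|exists 1%N] => //= -[].
suff : S (\bigcup_n (if n is 0%N then ~` (A `*` setT) else ~` (setT `*` B))).
  by move=> /SC.
apply: SU => -[|n]; first exact/SC/S1.
apply: SC; split; first exact: souslin_sub.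
rewrite (_ : ~` _ = setT `*` ~` B); first exact: souslin_sub.
by apply/seteqP; split => -[x y] /=; tauto.
Qed.

(* Decreasing closed subsets of a segment have a common point as soon as they are
   nonempty, so the projection can be computed level by level. *)
Lemma snd_souslin (H : set (R * T)) n : souslin closed_rectangles H ->
  souslin measurable (snd @` (H `&` (`[- n%:R, n%:R]%classic `*` setT))).
Proof.
move=> [C [GC hN HE]].
pose I0 : set R := `[- n%:R, n%:R]%classic.
(* The sides are chosen as a function of the rectangle alone: branches giving the same rectangle
   then give the same sides, so that finite determination passes to [A] and [B]. An empty rectangle
   has no canonical sides. *)
pose sides (S : set (R * T)) : set R * set T :=
  xget (set0, set0) [set p | [/\ closed p.1, measurable p.2 & S = p.1 `*` p.2]].
pose A k f := (sides (C k f)).1; pose B k f := (sides (C k f)).2.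
have ABP k f : [/\ closed (A k f), measurable (B k f) & C k f = A k f `*` B k f].
  have [A' cA' [B' mB' AB']] := GC k f; rewrite /A /B /sides.
  by case: xgetP => [[a b] _ [? ? ?] //|/(_ (A', B'))[]].
(* Nonemptiness of all these finite intersections is a condition on the branch alone, free of the
   point of [T]; by compactness it yields a common time for all levels. *)
pose capA k f := I0 `&` \bigcap_(j < k.+1) A j f.
exists (fun k f => if `[<capA k f !=set0>] then B k f else set0); split.
- by move=> k f; case: ifP => // _; case: (ABP k f).
- move=> k; have /choice[N hN'] := hN.
  exists (\max_(j < k.+1) N j) => f g fg.
  have Cfg j : (j < k.+1)%N -> C j f = C j g.
    move=> jk; apply: hN' => i iN; apply: fg; apply: leq_trans iN _.
    exact: (@leq_bigmax _ (fun j : 'I_k.+1 => N j) (Ordinal jk)).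
  have -> : capA k f = capA k g.
    by congr (_ `&` _); apply: eq_bigcapr => j /= jk; rewrite /A Cfg.
  by rewrite /B Cfg.
- apply/seteqP; split.
    move=> _ [[x y] [+ [/= xI _]] <-] /=; rewrite HE => -[f fC]; exists f => k.
    rewrite asboolT.
      by have [_ _ e] := ABP k f; have := fC k; rewrite e => -[].
    by exists x; split => // j _; have [_ _ e] := ABP j f; have := fC j; rewrite e => -[].
  move=> y [f hf].
  have capn k : capA k f !=set0.
    by have := hf k; case: asboolP.
  have By k : B k f y by have := hf k; case: asboolP => //.
  have cI : compact I0 by exact: segment_compact.
  have [x [xI xA]] : I0 `&` \bigcap_j A j f !=set0.
    move: cI; rewrite compact_In0 => /(_ nat setT (fun j => I0 `&` A j f)).
    rewrite (_ : I0 `&` \bigcap_j A j f = \bigcap_j (I0 `&` A j f)); last first.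
      apply/seteqP; split => [x [? h] j _|x h]; first by split => //; exact: h.
      by split => [|j _]; [case: (h 0%N Logic.I)|case: (h j Logic.I)].
    apply.
      by exists (fun j => A j f) => [j _|//]; case: (ABP j f).
    move=> D _; have [x [xI xA]] := capn (\max_(j <- finmap.enum_fset D) j)%N.
    exists x => j jD; split => //; apply: xA => /=.
    by rewrite ltnS; exact: (@leq_bigmax_seq _ _ xpredT (fun j => j)).
  exists (x, y) => //; split => //; rewrite HE; exists f => k.
  by have [_ _ ->] := ABP k f; split => //=; exact: xA.
Qed.

Lemma souslin_projection (H : set (measurableTypeR R * T)) :
  measurable H -> souslin measurable (snd @` H).
Proof.
move=> mH.
have -> : snd @` H =
    \bigcup_n snd @` (H `&` (`[- n%:R, n%:R]%classic `*` setT)).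
  apply/seteqP; split => [_ [[x y] Hxy <-]|_ [n _ [[x y] [Hxy _] <-]]]; last first.
    by exists (x, y).
  exists (Num.truncn `|x|).+1 => //; exists (x, y) => //; split => //; split => //=.
  by rewrite in_itv /= -ler_norml; exact/ltW/truncnS_gt.
apply: souslin_bigcup; first exact: measurableT.
by move=> n; apply: snd_souslin; exact: measurable_souslin.
Qed.

End projection.

(** * Borel sets of the one-point compactification, and joint measurability of the paths *)

Lemma g_sigma_algebra_ind {T} (G : set (set T)) (P : set T -> Prop) :
  P set0 -> (forall A, P A -> P (~` A)) ->
  (forall A : (set T)^nat, (forall n, P (A n)) -> P (\bigcup_n A n)) ->
  (forall A, G A -> P A) -> forall A, <<s G >> A -> P A.
Proof.
move=> P0 PC PU PG A; suff : <<s G >> `<=` P by exact.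
apply: smallest_sub => //.
by split => // B PB; rewrite setTD; exact: PC.
Qed.

Lemma measurable_generator (T : pointedType) (G : set (set T)) (A : set T) :
  G A -> measurable (A : set (g_sigma_algebraType G)).
Proof. exact: sub_gen_smallest. Qed.

Section StateSpace.
Context {R : realType} {E : pmetricType R}.
Hypothesis E_locally_compact : locally_compact [set: E].
Hypothesis E_separable : separable E.

(** The [K j] are the closures of balls with centre in the dense set and radius [k.+1%:R^-1],
    replaced by the empty set unless compact and inside [U]. *)
Lemma compact_nbhs_exhaustion (U : set E) : open U -> exists K : nat -> set E,
  [/\ forall j, compact (K j), forall j, K j `<=` U &
      forall x, U x -> exists j, nbhs x (K j)].
Proof.
move=> oU; have [S /countable_injP[f injf] dS] := E_separable.
pose q i := xget point [set x | S x /\ f x = i].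
have qf x : S x -> q (f x) = x.
  move=> Sx; rewrite /q; case: xgetP => [y _ [Sy fy]|/(_ x)/not_andP[]//].
  by apply: injf; rewrite ?inE.
pose B n := closure (ball (q (nat_unpair n).1) ((nat_unpair n).2.+1%:R^-1)).
exists (fun n => if `[<compact (B n) /\ B n `<=` U>] then B n else set0); split.
- by move=> n; case: ifPn => [/asboolP[]//|_]; exact: compact0.
- by move=> n; case: ifPn => [/asboolP[]//|_].
- move=> x Ux.
  have := @E_locally_compact x I; rewrite withinET => -[V xV [cV clV]].
  have /nbhs_ballP[e /= e0 eVU] : nbhs x (V `&` U).
    by apply: filterI => //; exact: open_nbhs_nbhs.
  (* For [y] within [r / 2] of [x], the closure of [ball y r] lies in [ball x (r / 2 + r + r)], and
     [r < e / 4] keeps this inside [ball x e]. *)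
  have e40 : 0 < e / 4 by rewrite divr_gt0.
  have [k _ hk] := near_infty_natSinv_lt (PosNum e40).
  pose r : R := k.+1%:R^-1.
  have r0 : 0 < r by rewrite invr_gt0.
  have re : r < e / 4 by exact: hk k (leqnn k).
  have r20 : 0 < r / 2 by rewrite divr_gt0.
  have [y [xy Sy]] : ball x (r / 2) `&` S !=set0.
    have [y [/interior_subset xy Sy]] : (ball x (r / 2))° `&` S !=set0.
      apply: dS; last exact: open_interior.
      by exists x; exact/nbhsx_ballx.
    by exists y.
  have Bsub : closure (ball y r) `<=` V `&` U.
    move=> z zcl; apply: eVU.
    have [w [/= yw zw]] := zcl _ (nbhsx_ballx z _ r0).
    have : ball x (r / 2 + r + r) z.
      by apply: ball_triangle (ball_sym zw); exact: ball_triangle xy yw.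
    by apply: le_ball; lra.
  exists (pickle (f y, k)); rewrite /B nat_unpairK /= qf// asboolT.
    apply: filterS (nbhsx_ballx x _ r20) => z xz; apply: subset_closure.
    by rewrite -[X in ball _ X]/r (splitr r); apply: ball_triangle xz; exact: ball_sym.
  split; last by move=> z /Bsub[].
  by apply: subclosed_compact cV _ => [|z /Bsub[]//]; exact: closed_closure.
Qed.

Lemma closed_Some_image (K : set E) : compact K -> @closed (opc E) (Some @` K).
Proof.
move=> cK; have clK : closed K.
  by apply: compact_closed cK; exact: metric_hausdorff.
rewrite -openC openE => -[x|] /= nK; rewrite /interior /=.
  have : nbhs x (~` K).
    apply: open_nbhs_nbhs; split; first exact: closed_openC.
    by move=> Kx; apply: nK; exists x.
  by apply: filterS => y nKy [z Kz [zy]]; apply: nKy; rewrite -zy.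
exists K => // y [[z nKz <-]|->] [w Kw]; last by [].
by case=> wz; apply: nKz; rewrite -wz.
Qed.

Lemma measurable_Some_preimage (Y : set (borel (opc E))) : measurable Y ->
  measurable (Some @^-1` Y : set (borel E)).
Proof.
move: Y; refine (@g_sigma_algebra_ind (opc E) open
  (fun Y => measurable (Some @^-1` Y : set (borel E))) _ _ _ _) => [|A mA|A mA|U oU].
- by rewrite preimage_set0.
- by rewrite preimage_setC; exact: measurableC.
- by rewrite preimage_bigcup; exact: bigcupT_measurable.
apply: measurable_generator.
refine (@open_comp E (opc E) Some U _ oU) => x _.
exact: one_point_compactification_some_continuous.
Qed.

Lemma measurable_fun_Some :
  measurable_fun setT (Some : borel E -> borel (opc E)).
Proof. by move=> _ Y mY; rewrite setTI; exact: measurable_Some_preimage. Qed.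

(* The traces on E of the open sets of E generate the Borel sets of the
   compactification, as [None] is the complement of E. *)
Lemma measurable_fun_opc d (T : measurableType d) (h : T -> borel (opc E)) :
  (forall U : set E, open U -> measurable (h @^-1` (Some @` U))) ->
  measurable_fun setT h.
Proof.
move=> hU.
have hT : measurable (h @^-1` (Some @` [set: E])) by apply: hU; exact: openT.
have hG : forall G : set (borel E), measurable G -> measurable (h @^-1` (Some @` G)).
  refine (@g_sigma_algebra_ind E open (fun G => measurable (h @^-1` (Some @` G))) _ _ _ _) => //.
  - by rewrite image_set0 preimage_set0.
  - move=> A mA.
    rewrite (_ : _ @^-1` _ = (h @^-1` (Some @` [set: E])) `\` (h @^-1` (Some @` A))).
      exact: measurableD.
    apply/seteqP; split => x /=.
      by move=> [y nAy <-]; split; [exists y|move=> [z Az [zy]]; apply: nAy; rewrite -zy].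
    by move=> [[y _ <-] nA]; exists y => // Ay; apply: nA; exists y.
  - move=> A mA; rewrite image_bigcup preimage_bigcup.
    exact: bigcupT_measurable.
move=> _ Y mY; rewrite setTI.
have -> : h @^-1` Y = (h @^-1` (Some @` (Some @^-1` Y))) `|`
    (if `[<Y None>] then ~` (h @^-1` (Some @` [set: E])) else set0).
  apply/seteqP; split => x /=.
    case e : (h x) => [y|] Yx; first by left; exists y.
    by right; rewrite asboolT//= e => -[].
  move=> [[y Yy <-]//|]; case: asboolP => //= YN; case: (h x) => // y [].
  by exists y.
apply: measurableU; first by apply: hG; exact: measurable_Some_preimage.
by case: ifP => // _; exact: measurableC.
Qed.

Lemma measurable_Some_image (G : set (borel E)) : measurable G ->
  measurable (Some @` G : set (borel (opc E))).
Proof.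
have mE : measurable (Some @` [set: E] : set (borel (opc E))).
  by apply: measurable_generator; apply: one_point_compactification_open_some; exact: openT.
move: G; refine (@g_sigma_algebra_ind E open
  (fun G => measurable (Some @` G : set (borel (opc E)))) _ _ _ _); last first.
- move=> U oU; apply: measurable_generator.
  exact: one_point_compactification_open_some.
- by move=> A mA /=; rewrite image_bigcup; exact: bigcupT_measurable.
- move=> A mA /=.
  rewrite (_ : _ @` _ = (Some @` [set: E]) `\` (Some @` A)); first exact: measurableD.
  apply/seteqP; split => x /=.
    by move=> [y nAy <-]; split; [exists y|move=> [z Az [zy]]; apply: nAy; rewrite -zy].
  by move=> [[y _ <-] nA]; exists y => // Ay; apply: nA; exists y.
- by rewrite /= image_set0.
Qed.

Lemma measurable_None : measurable ([set None] : set (borel (opc E))).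
Proof.
rewrite (_ : [set None] = ~` (Some @` [set: E])).
  by apply: measurableC; apply: measurable_Some_image.
by apply/seteqP; split => [_ -> [] //|[x|]//= []]; exists x.
Qed.

Lemma measurable_opc_set1 (y : opc E) :
  measurable ([set y] : set (borel (opc E))).
Proof.
case: y => [x|]; last exact: measurable_None.
rewrite -(setCK [set Some x]); apply: measurableC; apply: measurable_generator.
apply: closed_openC; rewrite -(image_set1 Some x); apply: closed_Some_image.
exact: compact_set1.
Qed.

Lemma measurable_fun_ext0 (f : E -> \bar R) :
  measurable_fun setT (f : borel E -> \bar R) ->
  measurable_fun setT (ext0 f : borel (opc E) -> \bar R).
Proof.
move=> mf _ Y mY; rewrite setTI.
have -> : (ext0 f : borel (opc E) -> _) @^-1` Y = (Some @` (f @^-1` Y)) `|`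
    (if `[<Y 0%E>] then [set None] else set0).
  apply/seteqP; split => [[x|] /= Yx|x]; first by left; exists x.
  - by right; rewrite asboolT.
  - by move=> [[y Yy <-//]|]; case: asboolP => // ? ->.
apply: measurableU.
  by apply: measurable_Some_image; rewrite -[X in measurable X]setTI; exact: mf.
by case: ifP => // _; exact: measurable_None.
Qed.

End StateSpace.

(** * Right-continuous paths are jointly measurable in time and outcome *)

Section JointMeasurability.
Context {R : realType} {E : pmetricType R}.
Hypothesis E_locally_compact : locally_compact [set: E].
Hypothesis E_separable : separable E.
Context {d : measure_display} {Omega : measurableType d}.
Variable X : R -> Omega -> opc E.
Hypothesis X_right_continuous :
  forall w (t : R), 0 <= t -> X ^~ w @ t^'+ --> X t w.

Definition history_generator (t : \bar R) : set (set Omega) :=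
  [set A | exists s : R, [/\ 0 <= s, (s%:E <= t)%E &
     exists2 B : set (borel (opc E)), measurable B & A = X s @^-1` B]].

(** F^0_t as a measurable type: its measurable sets are, by conversion, those of
    [natural_filtration X t]. *)
Definition history (t : \bar R) : measurableType _ :=
  g_sigma_algebraType (history_generator t).

(** The value [None] outside [[0, t[] makes the path total on [R]. The strict bound leaves room to
    approximate a time from the right by times before [t]. For [t = +oo] this is the whole path. *)
Definition killed_path (t : \bar R) (p : R * Omega) : opc E :=
  if (0 <= p.1) && (p.1%:E < t)%E then X p.1 p.2 else None.

Let right_grid (n : nat) (s : R) : R := (Num.truncn (s * n.+1%:R)).+1%:R / n.+1%:R.

Let right_gridP n (s : R) : 0 <= s -> s < right_grid n s <= s + n.+1%:R^-1.
Proof.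
move=> s0; rewrite /right_grid ltr_pdivlMr// truncnS_gt/=.
rewrite ler_pdivrMr// mulrDl mulVf// -natr1 lerD2r.
by rewrite truncn_le mulr_ge0.
Qed.

Let right_grid_cvg (s : R) : 0 <= s -> right_grid ^~ s @ \oo --> s^'+.
Proof.
move=> s0 V /nbhs_ballP[e /= e0 eV].
have [N _ hN] := near_infty_natSinv_lt (PosNum e0).
exists N => // n /= Nn; have /andP[h1 h2] := right_gridP n s0.
have hn : n.+1%:R^-1 < e := hN n Nn.
apply: eV => //=; rewrite /ball /= distrC ger0_norm ?subr_ge0 ?ltW//.
by rewrite ltrBlDl; apply: le_lt_trans h2 _; rewrite ltrD2l.
Qed.

Let near_lt_ereal (s : R) (t : \bar R) : (s%:E < t)%E ->
  \forall r \near s^'+, (r%:E < t)%E.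
Proof.
case: t => [t| |] //; last by move=> _; apply: nearW => r; rewrite ltry.
by rewrite lte_fin => st; under eq_near do rewrite lte_fin; exact: nbhs_right_lt.
Qed.

(* The grid points lie strictly to the right of [s] and eventually before [t], so
   that the approximations only involve the path up to time [t]. *)
Lemma measurable_killed_path (t : \bar R) : measurable_fun setT
  (killed_path t : measurableTypeR R * history t -> borel (opc E)).
Proof.
apply: measurable_fun_opc => U oU.
have [K [cK KU Knbhs]] := compact_nbhs_exhaustion E_locally_compact E_separable oU.
pose H j n : set (measurableTypeR R * history t) := [set p | 0 <= p.1 /\
  ((right_grid n p.1)%:E < t)%E /\ (Some @` K j) (X (right_grid n p.1) p.2)].
(* Left to right, some [K j] is a neighbourhood of the value, which the grid values approach. Right
   to left, the image of [K j] is closed, so it contains the limit. *)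
have -> : (killed_path t : measurableTypeR R * history t -> borel (opc E)) @^-1`
    (Some @` U) = \bigcup_j \bigcup_N \bigcap_(n >= N) H j n.
  apply/seteqP; split => [[s w]|[s w] [j _ [N _ h]]] /=.
    rewrite /killed_path /=; case: ifPn => [/andP[s0 st]|_ []//].
    move=> [x Ux Xx]; have [j Kx] := Knbhs x Ux; exists j => //.
    have cX : (fun n => X (right_grid n s) w) @ \oo --> X s w.
      exact: (cvg_comp _ _ (right_grid_cvg s0) (X_right_continuous (w := w) s0)).
    have ct : \forall n \near \oo, ((right_grid n s)%:E < t)%E.
      have := near_lt_ereal st; exact: right_grid_cvg.
    have := cX (Some @` K j); rewrite -Xx => /(_ (one_point_compactification_some_nbhs _ _ Kx)).
    move=> [N1 _ hN1]; have [N2 _ hN2] := ct.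
    exists (maxn N1 N2) => // n /=; rewrite geq_max => /andP[n1 n2].
    by split => //; split; [exact: hN2 n2|exact: hN1 n1].
  have [/= s0 _] := h N (leqnn N).
  rewrite /killed_path /= s0 /=.
  have [_ [/= gt _]] := h N (leqnn N).
  have /andP[sg _] := right_gridP N s0.
  rewrite (lt_trans _ gt) ?lte_fin//.
  have cX : (fun n => X (right_grid n s) w) @ \oo --> X s w.
    exact: (cvg_comp _ _ (right_grid_cvg s0) (X_right_continuous (w := w) s0)).
  have : (Some @` K j) (X s w).
    have cl : @closed (opc E) (Some @` K j) by exact: closed_Some_image.
    apply: cl; move=> V /cX VX.
    have KX : nbhs (X (right_grid n s) w @[n --> \oo]) (Some @` K j).
      by exists N => // n /= Nn; have [_ []] := h n Nn.
    by have [z []] := filter_ex (filterI KX VX); exists z.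
  by move=> [x Kx <-]; exists x => //; exact: KU Kx.
apply: bigcupT_measurable => j; apply: bigcupT_measurable => N.
apply: bigcap_measurable; first by exists N => /=.
move=> n _.
(* On each cell of the grid the grid point is constant, which leaves a product set. *)
have -> : H j n = \bigcup_k ([set s | 0 <= s /\ Num.truncn (s * n.+1%:R) = k] `*`
    [set w | ((k.+1%:R / n.+1%:R)%:E < t)%E /\ (Some @` K j) (X (k.+1%:R / n.+1%:R) w)]).
  apply/seteqP; split => [[s w] /= [s0 [gt Kg]]|[s w] [k _ [/= [s0 <-] [gt Kg]]]].
    by exists (Num.truncn (s * n.+1%:R)).
  by split.
apply: bigcupT_measurable => k; apply: measurableX.
  rewrite (_ : [set _ | _] = `[k%:R / n.+1%:R, k.+1%:R / n.+1%:R[%classic).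
    exact: measurable_itv.
  apply/seteqP; split => s /=; rewrite in_itv /= ler_pdivrMr// ltr_pdivlMr//.
    by move=> [s0 <-]; rewrite truncn_itv// mulr_ge0.
  move=> h; split; last exact: truncn_def.
  have /andP[h1 _] := h; rewrite -(@pmulr_lge0 _ n.+1%:R)//.
  exact: le_trans h1.
have [gt|gt] := pselect ((k.+1%:R / n.+1%:R)%:E < t)%E; last first.
  by rewrite (_ : [set _ | _] = set0)//; apply/seteqP; split => // w [].
rewrite (_ : [set _ | _] = X (k.+1%:R / n.+1%:R) @^-1` (Some @` K j)); last first.
  by apply/seteqP; split => [w []|w].
apply: measurable_generator; exists (k.+1%:R / n.+1%:R); split => //.
- exact: ltW.
- exists (Some @` K j) => //; rewrite -(setCK (Some @` K j)).
  apply: measurableC; apply: measurable_generator; apply: closed_openC.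
  exact: closed_Some_image.
Qed.

End JointMeasurability.

(** * Measurability of the laws of a Hunt process *)

Import HBNNSimple.

Lemma ge0_measurable_ind d (T : measurableType d) (R : realType)
    (Phi : (T -> \bar R) -> Prop) :
  (forall A, measurable A -> Phi (fun x => (\1_A x)%:E)) ->
  (forall (k : R) f, 0 <= k -> measurable_fun setT f -> (forall x, 0 <= f x)%E ->
     Phi f -> Phi (fun x => k%:E * f x)%E) ->
  (forall f g, measurable_fun setT f -> (forall x, 0 <= f x)%E ->
     measurable_fun setT g -> (forall x, 0 <= g x)%E ->
     Phi f -> Phi g -> Phi (fun x => f x + g x)%E) ->
  (forall f_ : (T -> \bar R)^nat, (forall n, measurable_fun setT (f_ n)) ->
     (forall n x, 0 <= f_ n x)%E -> (forall x, nondecreasing_seq (f_ ^~ x)) ->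
     (forall n, Phi (f_ n)) -> Phi (fun x => limn (f_ ^~ x))) ->
  forall f, measurable_fun setT f -> (forall x, 0 <= f x)%E -> Phi f.
Proof.
move=> H1 HZ HD HL f mf f0.
have Hnn (h : {nnsfun T >-> R}) : Phi (fun x => (h x)%:E).
  have -> : (fun x => (h x)%:E) = (fun x =>
      \sum_(r <- finmap.enum_fset (fset_set (range h))) (r%:E * (\1_(h @^-1` [set r]) x)%:E)%E).
    apply/funext => x; rewrite fimfunE fsbig_finite//= -sumEFin.
    by apply: eq_bigr => r _; rewrite EFinM.
  have : {in finmap.enum_fset (fset_set (range h)), forall r, 0 <= r}.
    by move=> r; rewrite in_fset_set// inE => -[x _ <-].
  elim: (finmap.enum_fset _) => [_|r s ih rs0].
    under eq_fun do rewrite big_nil.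
    by have := H1 set0 measurable0; under eq_fun do rewrite indic0.
  under eq_fun do rewrite big_cons.
  have r0 : 0 <= r by apply: rs0; rewrite mem_head.
  have m1 q : measurable_fun setT (fun x => (\1_(h @^-1` [set q]) x)%:E : \bar R).
    by apply/measurable_EFinP; exact: measurable_indic.
  have s0 : {in s, forall r, 0 <= r} by move=> q qs; apply: rs0; rewrite inE qs orbT.
  apply: HD.
  - by apply: measurable_funeM.
  - by move=> x; rewrite mule_ge0// lee_fin.
  - by apply: emeasurable_sum => q; exact: measurable_funeM.
  - move=> x; rewrite big_seq; apply: sume_ge0 => q qs.
    by rewrite mule_ge0// lee_fin// s0.
  - by apply: HZ => //; exact: H1.
  - exact: ih.
have -> : f = fun x => limn (fun n => (nnsfun_approx measurableT mf n x)%:E).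
  apply/funext => x; apply/esym/cvg_lim => //.
  exact: (cvg_nnsfun_approx measurableT mf (fun x _ => f0 x)).
apply: HL => [n|n x|x m n mn|n].
- exact/measurable_EFinP.
- by rewrite lee_fin.
- by rewrite lee_fin; exact/lefP/nd_nnsfun_approx.
- exact: Hnn.
Qed.

(* No measurability of [f]: the integral of a nonnegative function is a supremum
   over simple functions. This gives the Markov property under [P x] before
   [y |-> P y A] is known to be measurable. *)
Lemma integral_dirac_point d (T : measurableType d) (R : realType) (x : T)
    (f : T -> \bar R) : measurable [set x] -> (forall y, 0 <= f y)%E ->
  f x \is a fin_num -> (\int[\d_x]_y f y)%E = f x.
Proof.
move=> mx f0 fx; apply/eqP; rewrite eq_le; apply/andP; split.
  rewrite ge0_integralTE//; apply: ge_ereal_sup => _ [h hf <-].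
  rewrite -integralT_nnsfun integral_dirac//; last exact/measurable_EFinP.
  by rewrite diracT mul1e; exact: hf.
have r0 : 0 <= fine (f x) by exact: fine_ge0.
pose h : {nnsfun T >-> R} := scale_nnsfun (indic_nnsfun R mx) r0.
rewrite ge0_integralTE//; apply: ereal_sup_ubound; exists h.
  move=> y /=; rewrite mindicE; case: (boolP (y \in [set x])).
    by rewrite inE => ->; rewrite mulr1 fineK.
  by rewrite mulr0.
rewrite -integralT_nnsfun integral_dirac//; last exact/measurable_EFinP.
by rewrite diracT mul1e /h /= mindicE mem_set//= mulr1 fineK.
Qed.


Section dirac_probability.
Context d (T : measurableType d) (R : realType) (x : T).

(** A named Dirac measure that can carry the probability structure required of initial laws in the
    Hunt axioms. *)
Definition dirac_probability : set T -> \bar R := \d_x.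

HB.instance Definition _ := Measure.on dirac_probability.

Let dirac_setT : dirac_probability setT = 1%E. Proof. exact: diracT. Qed.

HB.instance Definition _ :=
  Measure_isProbability.Build _ _ _ dirac_probability dirac_setT.

End dirac_probability.

Section HuntKernel.
Context {R : realType} {E : pmetricType R}.
Context {d : measure_display} {Omega : measurableType d}.
Variables (X : R -> Omega -> opc E) (P : opc E -> probability Omega R).
Hypothesis X_Hunt : Hunt_process X P.
Local Open Scope ereal_scope.

Lemma natural_filtration_le (s t : \bar R) : s <= t ->
  natural_filtration X s `<=` natural_filtration X t.
Proof.
move=> st; apply: sub_sigma_algebra2 => A [r [r0 rs BA]].
by exists r; split => //; exact: le_trans st.
Qed.

Lemma natural_augmented t : natural_filtration X t `<=` augmented_filtration X P t.
Proof.
move=> A At mu; exists A => //; exists set0; first exact: sigma_algebra0.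
split; first by rewrite setDv setU0.
by under eq_integral do rewrite measure0; rewrite integral0.
Qed.

Lemma augmented_set0 t : augmented_filtration X P t set0.
Proof. by apply: natural_augmented; exact: sigma_algebra0. Qed.

Lemma natural_measurable (t : \bar R) A : natural_filtration X t A -> measurable A.
Proof.
move=> At; rewrite (hunt_sigma_field X_Hunt); apply: natural_augmented.
by apply: natural_filtration_le At; rewrite leey.
Qed.

Lemma natural_preimage (s : R) (t : \bar R) (G : set (borel (opc E))) :
  (0 <= s)%R -> s%:E <= t -> measurable G -> natural_filtration X t (X s @^-1` G).
Proof.
by move=> s0 st mG; apply: sub_sigma_algebra; exists s; split => //; exists G.
Qed.

Lemma measurable_path (s : R) : (0 <= s)%R ->
  measurable_fun setT (X s : Omega -> borel (opc E)).
Proof.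
move=> s0 _ G mG; rewrite setTI.
exact: (natural_measurable (natural_preimage s0 (leey _) mG)).
Qed.

Lemma is_law_dirac x : is_law X P (dirac_probability R (x : borel (opc E))) (P x).
Proof.
move=> A At; rewrite (@integral_dirac_point _ (borel (opc E)) R x (fun y => P y A))//.
- exact: measurable_opc_set1.
- by apply: fin_num_measure; exact: natural_measurable At.
Qed.

Lemma stopping_time_cst (r : R) : (0 <= r)%R -> stopping_time X P (fun=> r%:E).
Proof.
move=> r0; split => [w|t t0]; first by rewrite lee_fin.
have [rt|rt] := leP r%:E t%:E.
  rewrite (_ : [set _ | _] = setT); last by apply/seteqP.
  apply: natural_augmented; exact: (@measurableT _ (history X _)).
rewrite (_ : [set _ | _] = set0); last first.
  by apply/seteqP; split => // w /=; rewrite leNgt rt.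
exact: augmented_set0.
Qed.

Lemma natural_stopped (r : R) A : natural_filtration X r%:E A ->
  stopped_sigma_field X P (fun=> r%:E) A.
Proof.
move=> rA; split.
  by apply: natural_augmented; apply: natural_filtration_le rA; rewrite leey.
move=> t t0; have [rt|rt] := leP r%:E t%:E.
  rewrite (_ : [set _ | _] = setT) ?setIT; last by apply/seteqP.
  by apply: natural_augmented; exact: natural_filtration_le rA.
rewrite (_ : [set _ | _] = set0) ?setI0; last first.
  by apply/seteqP; split => // w /=; rewrite leNgt rt.
exact: augmented_set0.
Qed.

Lemma markov_property x (r t : R) A (G : set (borel (opc E))) :
  (0 <= r)%R -> (0 <= t)%R -> natural_filtration X r%:E A -> measurable G ->
  P x (A `&` X (r + t) @^-1` G) = \int[P x]_(w in A) P (X r w) (X t @^-1` G).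
Proof.
move=> r0 t0 rA mG.
have := hunt_strong_markov X_Hunt (is_law_dirac x) (stopping_time_cst r0) t0
  (natural_stopped rA) mG.
by [].
Qed.

Lemma measurable_kernel_integral (A : set Omega) (s : R) (phi : opc E -> \bar R) :
  measurable A -> (0 <= s)%R ->
  (forall G : set (borel (opc E)), measurable G ->
     measurable_fun setT ((fun x => P x (A `&` X s @^-1` G)) : borel (opc E) -> _)) ->
  measurable_fun setT (phi : borel (opc E) -> \bar R) -> (forall y, 0 <= phi y) ->
  measurable_fun setT
    ((fun x => \int[P x]_(w in A) phi (X s w)) : borel (opc E) -> \bar R).
Proof.
move=> mA s0 hA; move: phi.
have mXs (f : borel (opc E) -> \bar R) : measurable_fun setT f ->
    measurable_fun A (f \o X s : Omega -> \bar R).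
  move=> mf; apply: measurable_funTS; apply: measurableT_comp => //.
  exact: measurable_path.
refine (@ge0_measurable_ind _ (borel (opc E)) R (fun phi => measurable_fun setT
    ((fun x => \int[P x]_(w in A) phi (X s w)) : borel (opc E) -> \bar R)) _ _ _ _).
- move=> G mG; have := hA G mG.
  congr (measurable_fun _ _); apply/funext => x.
  have mG' : measurable (X s @^-1` G).
    exact: (natural_measurable (natural_preimage s0 (leey _) mG)).
  by rewrite (_ : (fun w => _) = (fun w => (\1_(X s @^-1` G) w)%:E))// integral_indic// setIC.
- move=> k f k0 mf f0 Hf.
  rewrite [X in measurable_fun _ X](_ : _ = (fun x => k%:E * \int[P x]_(w in A) f (X s w))).
    exact: measurable_funeM.
  by apply/funext => x; rewrite ge0_integralZl_EFin//; exact: mXs.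
- move=> f g mf f0 mg g0 Hf Hg.
  rewrite [X in measurable_fun _ X](_ : _ = (fun x => \int[P x]_(w in A) f (X s w) +
      \int[P x]_(w in A) g (X s w))).
    exact: emeasurable_funD.
  by apply/funext => x; rewrite ge0_integralD//; exact: mXs.
- move=> f_ mf f0 ndf Hf.
  rewrite [X in measurable_fun _ X](_ : _ =
      (fun x => limn (fun n => \int[P x]_(w in A) f_ n (X s w)))); last first.
    apply/funext => x.
    apply: (@monotone_convergence _ _ _ (P x) A mA (fun n w => f_ n (X s w))).
    + by move=> n; exact: mXs.
    + by move=> n w _; exact: f0.
    + by move=> w _; exact: ndf.
  apply: (emeasurable_fun_cvg (fun n (x : borel (opc E)) =>
    \int[P x]_(w in A) f_ n (X s w))) => // x _.
  apply: ereal_nondecreasing_is_cvgn => m n mn.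
  apply: ge0_le_integral => //; [exact: mXs|exact: mXs|].
  by move=> w _; exact: ndf.
Qed.

(* Cylinder sets with increasing times; the Markov property is applied at the
   last time of a cylinder. *)
Inductive cylinder : R -> set Omega -> Prop :=
| cylinder_setT : cylinder 0%R setT
| cylinder_step s t A (G : set (borel (opc E))) : (s <= t)%R -> measurable G ->
    cylinder s A -> cylinder t (A `&` X t @^-1` G).

Lemma cylinder_natural s A : cylinder s A -> (0 <= s)%R /\ natural_filtration X s%:E A.
Proof.
elim => [|{}s t {}A G st mG _ [s0 sA]].
  by split => //; exact: (@measurableT _ (history X _)).
have t0 : (0 <= t)%R by exact: le_trans st.
split => //.
have := @measurableI _ (history X t%:E) A (X t @^-1` G); apply.
  by apply: natural_filtration_le sA; rewrite lee_fin.
exact: natural_preimage.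
Qed.

(** Commuting the new constraint past the later ones keeps the times sorted; this is what makes
    cylinders stable under intersection. *)
Lemma cylinder_insert s A t (G : set (borel (opc E))) : cylinder s A ->
  (0 <= t)%R -> measurable G -> cylinder (Order.max s t) (A `&` X t @^-1` G).
Proof.
move=> + t0 mG; elim => [|{}s r {}A G' sr mG' sA ih].
  by rewrite max_r//; exact: (cylinder_step t0 mG cylinder_setT).
have [rt|tr] := leP r t.
  exact: (cylinder_step rt mG (cylinder_step sr mG' sA)).
rewrite -setIA (setIC (X r @^-1` _)) setIA.
by apply: (cylinder_step _ mG' ih); rewrite ge_max sr ltW.
Qed.

Lemma cylinderI s t A B : cylinder s A -> cylinder t B ->
  exists r, cylinder r (A `&` B).
Proof.
move=> sA; elim => [|{}t r {}B G tr mG tB [q ih]]; first by rewrite setIT; exists s.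
have [t0 _] := cylinder_natural tB.
rewrite setIA; eexists; exact: (cylinder_insert ih (le_trans t0 tr) mG).
Qed.

(** The extra constraint [G] at the last time closes the induction: it merges with the last
    constraint of the cylinder, and the Markov property at the preceding time [s] leaves the
    integral over a shorter cylinder of a function of [X s]. *)
Lemma measurable_cylinder_kernel s A : cylinder s A ->
  forall G : set (borel (opc E)), measurable G ->
  measurable_fun setT ((fun x => P x (A `&` X s @^-1` G)) : borel (opc E) -> _).
Proof.
elim => [|{}s t {}A G' st mG' sA ih] G mG.
  rewrite [X in measurable_fun _ X](_ : _ = (fun x => P x (X 0%R @^-1` G))).
    exact: (hunt_kernel X_Hunt).
  by apply/funext => x; rewrite setTI.
have [s0 sA'] := cylinder_natural sA.
have mGG : measurable (G' `&` G) by exact: measurableI.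
have ts0 : (0 <= t - s)%R by rewrite subr_ge0.
rewrite [X in measurable_fun _ X](_ : _ = (fun x =>
    \int[P x]_(w in A) P (X s w) (X (t - s)%R @^-1` (G' `&` G)))).
  apply: (@measurable_kernel_integral A s
    (fun y => P y (X (t - s)%R @^-1` (G' `&` G)))) => //.
    exact: natural_measurable sA'.
  exact: (hunt_kernel X_Hunt).
by apply/funext => x; rewrite -markov_property// subrKC -setIA.
Qed.

(** Dynkin's pi-lambda theorem, with the cylinders as generating pi-system. *)
Lemma measurable_kernel_natural A : natural_filtration X +oo A ->
  measurable_fun setT ((fun x => P x A) : borel (opc E) -> \bar R).
Proof.
move: A.
pose G := [set A | exists s, cylinder s A].
have GE : natural_filtration X +oo = <<s G >>.
  apply/seteqP; split.
    apply: smallest_sub; first exact: smallest_sigma_algebra.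
    move=> _ [s [s0 _ [B mB ->]]]; apply: sub_sigma_algebra.
    exists s; rewrite -[X in cylinder _ X]setTI.
    exact: (cylinder_step s0 mB cylinder_setT).
  apply: smallest_sub; first exact: smallest_sigma_algebra.
  by move=> A [s /cylinder_natural[_]]; apply: natural_filtration_le; rewrite leey.
move=> A; rewrite GE; move: A.
apply: (@dynkin_induction _ (history X +oo) G
  (fun A => measurable_fun setT ((fun x => P x A) : borel (opc E) -> \bar R))) => //.
- move=> A B [s sA] [t tB]. exact: cylinderI sA tB.
- rewrite [X in measurable_fun _ X](_ : _ = cst 1); first exact: measurable_cst.
  by apply/funext => x; exact: probability_setT.
- move=> A [s sA]; have := @measurable_cylinder_kernel s A sA setT measurableT.
  rewrite [X in measurable_fun _ X](_ : _ = (fun x => P x A))//.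
  by apply/funext => x; rewrite preimage_setT setIT.
- move=> A mA hA.
  rewrite [X in measurable_fun _ X](_ : _ = (fun x => 1 - P x A)).
    exact: emeasurable_funB.
  apply/funext => x; rewrite probability_setC//.
  exact: (@natural_measurable +oo _ _).
- move=> F mF tF hF.
  rewrite [X in measurable_fun _ X](_ : _ = (fun x => \sum_(n <oo) P x (F n))).
    by apply: ge0_emeasurable_sum => // n x _ _.
  apply/funext => x; rewrite measure_semi_bigcup//.
    by move=> n; apply: (@natural_measurable +oo); exact: mF.
  by apply: bigcupT_measurable => n; apply: (@natural_measurable +oo); exact: mF.
Qed.

End HuntKernel.

(** * The debut of a Borel set *)

Section Mixture.
Context {R : realType} {E : pmetricType R}.
Context {d : measure_display} {Omega : measurableType d}.
Variables (X : R -> Omega -> opc E) (P : opc E -> probability Omega R).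
Hypothesis X_Hunt : Hunt_process X P.
Variables (mu : probability (borel (opc E)) R) (t : \bar R).
Local Open Scope ereal_scope.

(** This is P_mu restricted to F^0_t, so that the measurable approximations of a Souslin set are
    found in F^0_t itself. *)
Definition mixture (A : set (history X t)) : \bar R := \int[mu]_x P x A.

Let historyW (A : set (history X t)) : measurable A -> natural_filtration X +oo A.
Proof. by move=> mA; apply: (natural_filtration_le (leey t)). Qed.

Let history_measurable (A : set (history X t)) : measurable A ->
  measurable (A : set Omega).
Proof. by move=> mA; exact: (natural_measurable X_Hunt mA). Qed.

Let kernel_measurable (A : set (history X t)) : measurable A ->
  measurable_fun setT ((fun x => P x A) : borel (opc E) -> \bar R).
Proof.
move=> /historyW.
exact: (measurable_kernel_natural X_Hunt).
Qed.

Let mixture0 : mixture set0 = 0.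
Proof.
rewrite /mixture; under eq_integral do rewrite measure0.
by rewrite integral0.
Qed.

Let mixture_ge0 A : 0 <= mixture A.
Proof. exact: integral_ge0. Qed.

Let mixture_sigma_additive : semi_sigma_additive mixture.
Proof.
move=> F mF tF mUF.
rewrite (_ : mixture _ = \sum_(n <oo) mixture (F n)).
  by apply: is_cvg_ereal_nneg_natsum => n _; exact: mixture_ge0.
rewrite /mixture -integral_nneseries//; last first.
   by move=> n; exact: kernel_measurable.
apply: eq_integral => x _; rewrite measure_semi_bigcup//.
  by move=> n; exact: history_measurable.
exact: history_measurable.
Qed.

HB.instance Definition _ := isMeasure.Build _ _ _
  mixture mixture0 mixture_ge0 mixture_sigma_additive.

Let mixture_finite : fin_num_fun mixture.
Proof.
move=> A mA; rewrite ge0_fin_numE ?mixture_ge0//.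
apply: (@le_lt_trans _ _ (\int[mu]_x (cst 1) x)).
  apply: ge0_le_integral => //.
    exact: kernel_measurable.
  by move=> x _; apply: probability_le1; exact: history_measurable.
by rewrite integral_cst// mul1e (le_lt_trans (probability_le1 _ _))// ltry.
Qed.

HB.instance Definition _ := Measure_isFinite.Build _ _ _ mixture mixture_finite.

Lemma souslin_history (H : set Omega) :
  souslin (measurable : set (set (history X t))) H ->
  exists2 A, natural_filtration X t A &
    law_null X P mu ((H `\` A) `|` (A `\` H)).
Proof.
move=> /(souslin_measurable mixture)[K [M [mK mM KH HM MK0]]].
exists K => //; exists (M `\` K); first by apply: historyW; exact: measurableD.
split => // w [[Hw nKw]|[Kw nHw]]; first by split => //; exact: HM.
by case: nHw; exact: KH.
Qed.

End Mixture.

(** * The debut is a stopping time *)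

Section Debut.
Context {R : realType} {E : pmetricType R}.
Hypothesis E_locally_compact : locally_compact [set: E].
Hypothesis E_separable : separable E.
Context {d : measure_display} {Omega : measurableType d}.
Variables (X : R -> Omega -> opc E) (P : opc E -> probability Omega R).
Hypothesis X_Hunt : Hunt_process X P.
Variable B : set (borel E).
Hypothesis mB : measurable B.
Local Open Scope ereal_scope.

Lemma debut_out_ge0 w : 0 <= debut_out X B w.
Proof. by apply: le_ereal_inf_tmp => _ [t [t0 _] <-]; rewrite lee_fin. Qed.

(** An infimum is strictly below [q] exactly when some element is, so the strict inequality produces
    a projection. Only the path before [s] enters. *)
Lemma debut_out_lt (q s : \bar R) : q <= s ->
  [set w | debut_out X B w < q] = snd @`
    (((killed_path X s : measurableTypeR R * history X s -> borel (opc E)) @^-1`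
       (Some @` (~` B))) `&` ([set r : R | r%:E < q] `*` setT)).
Proof.
move=> qs; apply/seteqP; split => [w /= /ereal_inf_lt[_ [r [r0 [x nBx Xx]] <-] rq]|].
  exists (r, w) => //; split; last by split.
  by rewrite /killed_path /= r0 (lt_le_trans rq qs); exists x.
move=> _ [[r w] [/= h [rq _]] <-] /=; move: h; rewrite /killed_path /=.
case: ifPn => [/andP[r0 rs]|_] [x nBx]// Xx.
by apply: le_lt_trans rq; apply: ereal_inf_lbound; exists r => //; split => //; exists x.
Qed.

(** By right continuity of the filtration it suffices to place the event in the augmented field at
    every [s > t]. The times [t + (s - t) / n.+1%:R] decrease to [t] and do not exceed [s], so the
    strict events are Souslin over F^0_s. *)
Lemma stopping_time_debut_out : stopping_time X P (debut_out X B).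
Proof.
split; first exact: debut_out_ge0.
move=> t t0; rewrite (hunt_filtration X_Hunt)// => s /= ts.
have mk := @measurable_killed_path _ _ E_locally_compact E_separable _ _ _
  (hunt_right_continuous X_Hunt) s%:E.
have sD : souslin (measurable : set (set (history X s%:E)))
    [set w | debut_out X B w <= t%:E].
  rewrite (_ : [set w | _] = \bigcap_n
      [set w | debut_out X B w < (t + (s - t) / n.+1%:R)%:E]); last first.
    apply/seteqP; split => [w /= Dt n _|w /= Dt].
      by apply: le_lt_trans Dt _; rewrite lte_fin ltrDl divr_gt0// subr_gt0.
    apply/lee_addgt0Pr => e e0.
    have es0 : (0 < e / (s - t))%R by rewrite divr_gt0// subr_gt0.
    have [n _ hn] := near_infty_natSinv_lt (PosNum es0).
    apply/ltW; apply: lt_trans (Dt n I) _.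
    rewrite -EFinD lte_fin ltrD2l mulrC -ltr_pdivlMr ?subr_gt0//.
    exact: (hn n (leqnn n)).
  apply: souslin_bigcap => n.
  rewrite (@debut_out_lt _ s%:E); last first.
    rewrite lee_fin -lerBrDl ler_pdivrMr// ler_peMr ?subr_ge0 ?(ltW ts)//.
    by rewrite ler1n.
  apply: souslin_projection; apply: measurableI.
    rewrite -[X in measurable X]setTI; apply: mk => //.
    by apply: measurable_Some_image; exact: measurableC.
  apply: measurableX => //.
  rewrite (_ : [set r : R | _] = `]-oo, (t + (s - t) / n.+1%:R)%R[%classic).
    exact: measurable_itv.
  by apply/seteqP; split => r /=; rewrite in_itv /= lte_fin.
by move=> mu; exact: (souslin_history X_Hunt mu sD).
Qed.

Lemma augmented_le (s t : \bar R) : s <= t ->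
  augmented_filtration X P s `<=` augmented_filtration X P t.
Proof.
move=> st A hA mu; have [A' sA' ?] := hA mu.
by exists A' => //; exact: natural_filtration_le sA'.
Qed.

Lemma stopping_time_measurable s : stopping_time X P s ->
  measurable_fun setT (s : Omega -> \bar R).
Proof.
move=> [s0 hs]; apply: (measurability _ (ErealGenOInfty.measurableE R)) => //.
move=> _ [_ [x ->] <-]; rewrite setTI.
have [x0|x0] := leP 0%R x; last first.
  rewrite (_ : _ @^-1` _ = setT)//; apply/seteqP; split => // w _ /=.
  by rewrite in_itv /= andbT (lt_le_trans _ (s0 w))// lte_fin.
rewrite (_ : _ @^-1` _ = ~` [set w | s w <= x%:E]).
  apply: measurableC; rewrite (hunt_sigma_field X_Hunt).
  by apply: augmented_le (hs x x0); rewrite leey.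
apply/seteqP; split => w /=; rewrite in_itv /= andbT.
  by rewrite ltNge => /negP.
by move=> /negP; rewrite -ltNge.
Qed.

Lemma stopping_time_le_stopped (s : Omega -> \bar R) (r : R) : (0 <= r)%R ->
  stopping_time X P s -> stopped_sigma_field X P s [set w | s w <= r%:E].
Proof.
move=> r0 [s0 hs]; split; first by apply: augmented_le (hs r r0); rewrite leey.
move=> t t0; rewrite (_ : _ `&` _ = [set w | s w <= (Num.min r t)%:E]).
  apply: augmented_le (hs _ _); rewrite ?lee_fin ?ge_min ?lexx ?orbT//.
  by rewrite le_min r0.
by apply/seteqP; split => w /=; rewrite EFin_min le_min => /andP.
Qed.

End Debut.

(** * Discounting *)

Section Discount.
Context {R : realType}.
Implicit Types (a s t : R).
Notation lambda := (@lebesgue_measure R).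

Lemma integral_lebesgue_translation s (f : R -> \bar R) :
  measurable_fun setT (f : measurableTypeR R -> \bar R) -> (forall t, 0 <= f t)%E ->
  (\int[lambda]_t f (s + t)%R = \int[lambda]_t f t)%E.
Proof.
move=> mf f0.
have ms : measurable_fun setT
    ((fun t : R => s + t) : measurableTypeR R -> measurableTypeR R).
  exact: measurable_funD.
rewrite -(ge0_integral_pushforward ms lambda measurableT mf (fun t _ => f0 t)).
apply: eq_measure_integral => A mA _; apply/esym.
apply: (lebesgue_measure_unique _ mA) => _ [[b c] _ <-] /=.
rewrite /pushforward (_ : _ @^-1` _ = `]b - s, c - s]%classic).
  rewrite !lebesgue_measure_itv/= !lte_fin ltrD2r -!EFinB.
  by rewrite opprB addrA addrNK.
by apply/seteqP; split => t /=; rewrite !in_itv/= ltrBlDl lerBrDl.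
Qed.

(** Vanishing at negative times lets integrals run over all of [R], where they can be translated. *)
Definition discount a t : \bar R := (if 0 <= t then expR (- (a * t)) else 0)%:E.

Lemma discount_ge0 a t : (0 <= discount a t)%E.
Proof. by rewrite /discount; case: ifP => _; rewrite lee_fin// expR_ge0. Qed.

Lemma measurable_discount a : measurable_fun setT (discount a : measurableTypeR R -> _).
Proof.
apply/measurable_EFinP; apply: measurable_fun_ifT => //.
  exact: measurable_fun_ler.
by apply: measurableT_comp => //; apply: measurableT_comp => //.
Qed.

Lemma discountD a s t : 0 <= s -> 0 <= t ->
  discount a (s + t) = ((expR (- (a * s)))%:E * discount a t)%E.
Proof.
by move=> s0 t0; rewrite /discount addr_ge0// t0 mulrDr opprD expRD EFinM.
Qed.

Lemma integral_discount a : 0 < a -> (\int[lambda]_t discount a t = (a^-1)%:E)%E.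
Proof.
move=> a0; have := integral_exponential_pdf a0.
rewrite (_ : (fun x => _) = (fun t => a%:E * discount a t)%E); last first.
  apply/funext => t; rewrite /exponential_pdf /discount /patch.
  case: (leP 0 t) => t0; last by rewrite memNset ?mule0//= in_itv/= andbT leNgt t0.
  by rewrite mem_set/= ?in_itv/= ?t0// mulNr EFinM.
rewrite ge0_integralZl_EFin//; last exact: ltW.
  move=> h; rewrite -[LHS]mul1e -(mulVf (lt0r_neq0 a0)) EFinM -muleA h mule1//.
  by move=> t _; exact: discount_ge0.
exact: measurable_discount.
Qed.

Lemma integral_discount_tail a s : 0 < a -> 0 <= s ->
  (\int[lambda]_t (if (s <= t)%R then discount a t else 0) =
   (expR (- (a * s)))%:E * (a^-1)%:E)%E.
Proof.
move=> a0 s0; rewrite -(@integral_lebesgue_translation s); last 2 first.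
- apply: measurable_fun_ifT => //; first exact: measurable_fun_ler.
  exact: measurable_discount.
- by move=> t; case: ifP => // _; exact: discount_ge0.
rewrite -integral_discount// -ge0_integralZl_EFin ?expR_ge0//; last 2 first.
- by move=> t _; exact: discount_ge0.
- exact: measurable_discount.
apply: eq_integral => t _; rewrite lerDl; case: ifP => t0; first by rewrite discountD.
by rewrite /discount t0 mule0.
Qed.

End Discount.

(** * Expectations with a random discount *)

Section LayerCake.
Context {R : realType} d (T : measurableType d).
Variables (mu : {finite_measure set T -> \bar R}) (a : R) (s : T -> \bar R).
Hypotheses (a_gt0 : 0 < a) (ms : measurable_fun setT s) (s_ge0 : forall w, (0 <= s w)%E).
Local Open Scope ereal_scope.
Notation lambda := (@lebesgue_measure R).

Definition discount_at (w : T) : \bar R :=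
  if s w is r%:E then (expR (- (a * r)))%:E else 0.

Lemma discount_at_ge0 w : 0 <= discount_at w.
Proof. by rewrite /discount_at; case: (s w) => [r| |]//; rewrite lee_fin expR_ge0. Qed.

Lemma discount_atE w : discount_at w =
  if s w < +oo then (expR (- (a * fine (s w))))%:E else 0.
Proof.
rewrite /discount_at; case: (s w) (s_ge0 w) => [r| |]//=.
by rewrite ltry.
Qed.

Lemma measurable_discount_at : measurable_fun setT discount_at.
Proof.
rewrite (_ : discount_at = (fun w => if s w < +oo then
    (expR (- (a * fine (s w))))%:E else 0)); last by apply/funext => w; exact: discount_atE.
apply: measurable_fun_ifT => //; first exact: measurable_fun_lte.
apply/measurable_EFinP; apply: measurableT_comp => //; apply: measurableT_comp => //.
apply: measurable_funM => //; exact: measurableT_comp.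
Qed.

Let tail_integral (W : T -> \bar R) : measurable_fun setT W -> (forall w, 0 <= W w) ->
  \int[lambda]_r (discount a r * \int[mu]_(w in [set w | s w <= r%:E]) W w) =
  (a^-1)%:E * \int[mu]_w (discount_at w * W w).
Proof.
move=> mW W0.
have mset r : measurable [set w | s w <= r%:E].
  rewrite -[X in measurable X]setTI; apply: measurable_lee => //.
pose f (p : measurableTypeR R * T) := (if s p.2 <= p.1%:E then discount a p.1 else 0) * W p.2.
have mf : measurable_fun setT f.
  apply: emeasurable_funM; last exact: measurableT_comp.
  apply: measurable_fun_ifT => //; last first.
    by apply: measurableT_comp => //; exact: measurable_discount.
  apply: measurable_fun_lee; first exact: measurableT_comp.
  by apply/measurable_EFinP.
have f0 p : 0 <= f p.
  by rewrite /f mule_ge0//; case: ifP => // _; exact: discount_ge0.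
transitivity (\int[lambda]_r \int[mu]_w f (r, w)).
  apply: eq_integral => r _; rewrite integral_mkcond -ge0_integralZl//; last 3 first.
  - by apply/(measurable_restrictT _ _).1 => //; exact: measurable_funTS.
  - by move=> w _; rewrite /patch; case: ifP.
  - exact: discount_ge0.
  apply: eq_integral => w _; rewrite /f /patch /=.
  case: ifPn => [|sr]; first by rewrite inE /= => ->.
  by rewrite ifN ?mul0e ?mule0//; apply: contra sr => sr; rewrite inE.
rewrite (fubini_tonelli f mf f0).
transitivity (\int[mu]_w ((a^-1)%:E * (discount_at w * W w))).
  apply: eq_integral => w _; rewrite /f /= ge0_integralZr//; last 2 first.
  - apply: measurable_fun_ifT => //; last exact: measurable_discount.
    apply: measurable_fun_lee => //.
  - by move=> r _; case: ifP => // _; exact: discount_ge0.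
  rewrite muleA; congr (_ * _).
  rewrite /discount_at; case: (s w) (s_ge0 w) => [r| |]//.
    rewrite lee_fin => r0; under eq_integral do rewrite lee_fin.
    by rewrite integral_discount_tail// muleC.
  by move=> _; rewrite mule0 integral0_eq.
rewrite ge0_integralZl_EFin//.
- by move=> w _; rewrite mule_ge0// discount_at_ge0.
- by apply: emeasurable_funM => //; exact: measurable_discount_at.
- by rewrite invr_ge0 ltW.
Qed.

(* [exp(-a s) = a \int_(r >= s) exp(-a r) dr] turns the weight into a mixture of the
   events [s <= r], on which the strong Markov property is available. *)
Lemma discounted_integral_eq (Y Z : T -> \bar R) :
  measurable_fun setT Y -> (forall w, 0 <= Y w) ->
  measurable_fun setT Z -> (forall w, 0 <= Z w) ->
  (forall r : R, (0 <= r)%R -> \int[mu]_(w in [set w | s w <= r%:E]) Y w =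
                     \int[mu]_(w in [set w | s w <= r%:E]) Z w) ->
  \int[mu]_w (discount_at w * Y w) = \int[mu]_w (discount_at w * Z w).
Proof.
move=> mY Y0 mZ Z0 YZ.
suff : (a^-1)%:E * \int[mu]_w (discount_at w * Y w) =
       (a^-1)%:E * \int[mu]_w (discount_at w * Z w).
  move=> /(congr1 (fun x => a%:E * x)).
  by rewrite !muleA -!EFinM !mulfV ?gt_eqF// !mul1e.
rewrite -(tail_integral mY Y0) -(tail_integral mZ Z0); apply: eq_integral => r _.
have [r0|r0] := leP 0%R r; first by rewrite YZ.
by rewrite /discount leNgt r0 !mul0e.
Qed.

End LayerCake.

(** * The strong Markov property *)

Section SpaceTimeKernel.
Context {R : realType} {E : pmetricType R}.
Context {d : measure_display} {Omega : measurableType d}.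
Variables (X : R -> Omega -> opc E) (P : opc E -> probability Omega R).
Hypothesis X_Hunt : Hunt_process X P.
Local Open Scope ereal_scope.

Notation past := (history X +oo).

Lemma measurable_to_history : measurable_fun setT ((fun w => w) : Omega -> past).
Proof. by move=> _ A mA; rewrite setTI; exact: (natural_measurable X_Hunt mA). Qed.

Let history_measurable (A : set past) : measurable A -> measurable (A : set Omega).
Proof. by move=> mA; exact: (natural_measurable X_Hunt mA). Qed.

(** The measure ignores the time coordinate, which is carried because integrands depend on it. It
    lives on F^0_oo, where measurability in the starting point is known. *)
Definition space_time_law (p : borel (opc E) * measurableTypeR R)
  (A : set past) : \bar R := P p.1 A.

Section space_time_kernel_measure.
Variable p : borel (opc E) * measurableTypeR R.

Let stk0 : space_time_law p set0 = 0. Proof. exact: measure0. Qed.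

Let stk_ge0 A : 0 <= space_time_law p A. Proof. exact: measure_ge0. Qed.

Let stk_sigma_additive : semi_sigma_additive (space_time_law p).
Proof.
move=> F mF tF mUF; apply: measure_semi_sigma_additive => //.
  by move=> n; exact: history_measurable.
exact: history_measurable.
Qed.

HB.instance Definition _ := isMeasure.Build _ _ _
  (space_time_law p) stk0 stk_ge0 stk_sigma_additive.

End space_time_kernel_measure.

Definition space_time_kernel :
    borel (opc E) * measurableTypeR R -> {measure set past -> \bar R} :=
  fun p => space_time_law p.

Let stk_measurable (A : set past) : measurable A ->
  measurable_fun setT (space_time_kernel ^~ A).
Proof.
move=> mA; apply: (measurableT_comp (measurable_kernel_natural X_Hunt mA)).
exact: measurable_fst.
Qed.

HB.instance Definition _ := isKernel.Build _ _ _ _ R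
  space_time_kernel stk_measurable.

Let stk_uub : measure_fam_uub space_time_kernel.
Proof.
exists 2%R => p; rewrite /space_time_kernel /= /space_time_law.
by apply: (le_lt_trans (probability_le1 _ _)) => //; rewrite lte_fin ltr1n.
Qed.

HB.instance Definition _ := Kernel_isFinite.Build _ _ _ _ R
  space_time_kernel stk_uub.

Lemma integral_history y (f : past -> \bar R) : measurable_fun setT f ->
  (forall w, 0 <= f w) ->
  \int[P y]_w f w = \int[space_time_kernel (y, 0%R)]_w f w.
Proof.
move=> mf f0.
have := ge0_integral_pushforward measurable_to_history (P y) measurableT mf (fun w _ => f0 w).
rewrite preimage_setT => <-.
by apply: eq_measure_integral => [|? A mA _ //]; exact: measurable_to_history.
Qed.

Lemma measurable_space_time_integral (k : measurableTypeR R * past -> \bar R) :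
  measurable_fun setT k -> (forall p, 0 <= k p) ->
  measurable_fun setT (fun p : borel (opc E) * measurableTypeR R =>
    \int[P p.1]_w k (p.2, w)).
Proof.
move=> mk k0.
pose k' (q : (borel (opc E) * measurableTypeR R) * past) := k (q.1.2, q.2).
have mk' : measurable_fun setT k'.
  apply: (measurableT_comp mk); apply/measurable_fun_pairP; split => /=.
    by apply: (measurableT_comp measurable_snd); exact: measurable_fst.
  exact: measurable_snd.
have := measurable_fun_integral_finite_kernel k' (space_time_kernel :
  R.-fker (borel (opc E) * measurableTypeR R)%type ~> past) (fun z => k0 _) mk'.
congr (measurable_fun _ _); apply/funext => p.
rewrite (@integral_history p.1 (fun w => k (p.2, w)))//.
by apply: (measurableT_comp mk); exact: measurable_pair1.
Qed.

End SpaceTimeKernel.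

(** * From one-time events to resolvents at a stopping time *)

Section StrongMarkov.
Context {R : realType} {E : pmetricType R}.
Hypothesis E_locally_compact : locally_compact [set: E].
Hypothesis E_separable : separable E.
Context {d : measure_display} {Omega : measurableType d}.
Variables (X : R -> Omega -> opc E) (P : opc E -> probability Omega R).
Hypothesis X_Hunt : Hunt_process X P.
Local Open Scope ereal_scope.
Notation lambda := (@lebesgue_measure R).
Notation path := (killed_path X +oo).

Lemma killed_pathE (t : R) w : (0 <= t)%R -> path (t, w) = X t w.
Proof. by move=> t0; rewrite /killed_path /= t0 ltry. Qed.

Lemma measurable_path_past : measurable_fun setT
  (path : measurableTypeR R * history X +oo -> borel (opc E)).
Proof.
exact: (measurable_killed_path E_locally_compact E_separable
  (hunt_right_continuous X_Hunt)).
Qed.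

Lemma measurable_joint_path : measurable_fun setT
  (path : measurableTypeR R * Omega -> borel (opc E)).
Proof.
apply: (@measurableT_comp _ _ _ _ _ _
  (path : measurableTypeR R * history X +oo -> borel (opc E)) _
  (fun p : measurableTypeR R * Omega => (p.1, p.2 : history X +oo))).
  exact: measurable_path_past.
apply/measurable_fun_pairP; split => /=; first exact: measurable_fst.
exact: (measurableT_comp (measurable_to_history X_Hunt) measurable_snd).
Qed.

(** Defined at the cemetery too, since the position at a stopping time may be [None]. *)
Definition resolvent_opc (a : R) (phi : opc E -> \bar R) (y : opc E) : \bar R :=
  \int[P y]_w \int[lambda]_t (discount a t * phi (path (t, w))).

Definition transition (phi : opc E -> \bar R)
    (p : borel (opc E) * measurableTypeR R) : \bar R :=
  \int[P p.1]_w phi (path (p.2, w)).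

Section nonneg_function.
Variable phi : opc E -> \bar R.
Hypothesis mphi : measurable_fun setT (phi : borel (opc E) -> \bar R).
Hypothesis phi0 : forall y, 0 <= phi y.

Lemma measurable_transition : measurable_fun setT (transition phi).
Proof.
apply: (measurable_space_time_integral X_Hunt (k := fun p => phi (path p))) => //.
by apply: (measurableT_comp mphi); exact: measurable_path_past.
Qed.

Lemma measurable_discounted_path a : measurable_fun setT
  (fun p : measurableTypeR R * Omega => discount a p.1 * phi (path p)).
Proof.
apply: emeasurable_funM.
  by apply: measurableT_comp => //; exact: measurable_discount.
by apply: (measurableT_comp mphi); exact: measurable_joint_path.
Qed.

Let pair_swap (f : measurableTypeR R * Omega -> \bar R) :
  measurable_fun setT f -> measurable_fun setT (fun p => f (p.2, p.1)).
Proof.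
move=> mf; apply: (measurableT_comp mf); apply/measurable_fun_pairP.
by split => /=; [exact: measurable_snd|exact: measurable_fst].
Qed.

Lemma resolvent_opcE a y : resolvent_opc a phi y =
  \int[lambda]_t (discount a t * transition phi (y, t)).
Proof.
rewrite /resolvent_opc.
rewrite (fubini_tonelli (fun p : Omega * measurableTypeR R =>
  discount a p.2 * phi (path (p.2, p.1)))).
- apply: eq_integral => t _ /=; rewrite ge0_integralZl//.
  + apply: (measurableT_comp mphi).
    by apply: (measurableT_comp measurable_joint_path); exact: measurable_pair1.
  + exact: discount_ge0.
- exact: (pair_swap (measurable_discounted_path a)).
- by move=> p; rewrite mule_ge0// discount_ge0.
Qed.

Lemma resolvent_opc_ge0 a y : 0 <= resolvent_opc a phi y.
Proof.
apply: integral_ge0 => w _; apply: integral_ge0 => t _.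
by rewrite mule_ge0// discount_ge0.
Qed.

Lemma measurable_resolvent_opc a :
  measurable_fun setT (resolvent_opc a phi : borel (opc E) -> \bar R).
Proof.
rewrite (_ : resolvent_opc a phi = (fun y : borel (opc E) =>
    \int[lambda]_t (discount a t * transition phi (y, t)))); last first.
  by apply/funext => y; exact: resolvent_opcE.
apply: (measurable_fun_fubini_tonelli_F
  (fun p : borel (opc E) * measurableTypeR R => discount a p.2 * transition phi p)).
- apply: emeasurable_funM; last exact: measurable_transition.
  by apply: measurableT_comp => //; exact: measurable_discount.
- by move=> p; rewrite mule_ge0 ?discount_ge0//; exact: integral_ge0.
Qed.

End nonneg_function.

Section stopping.
Variables (s : Omega -> \bar R) (x : opc E).
Hypothesis hs : stopping_time X P s.

Let ms : measurable_fun setT s. Proof. exact: stopping_time_measurable hs. Qed.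
Let s0 w : 0 <= s w. Proof. by case: hs. Qed.

(** The path after [s], written through the killed path in order to inherit its joint
    measurability. *)
Definition shifted_path (p : measurableTypeR R * Omega) : opc E :=
  if (0 <= p.1)%R && (s p.2 < +oo) then path (fine (s p.2) + p.1, p.2)%R else None.

Lemma shifted_pathE (t : R) w : (0 <= t)%R ->
  shifted_path (t, w) = at_time X (s w + t%:E) w.
Proof.
move=> t0; rewrite /shifted_path t0 /=.
case: (s w) (s0 w) => [r| |]//= r0; rewrite ltry killed_pathE//.
by rewrite addr_ge0.
Qed.

Lemma measurable_shifted_path : measurable_fun setT
  (shifted_path : measurableTypeR R * Omega -> borel (opc E)).
Proof.
apply: measurable_fun_ifT => //.
  apply: measurable_and => /=; first exact: measurable_fun_ler.
  by apply: measurable_fun_lte => //; exact: measurableT_comp.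
apply: (measurableT_comp measurable_joint_path).
apply/measurable_fun_pairP; split => /=; last exact: measurable_snd.
apply: measurable_funD => //.
by apply: measurableT_comp => //; exact: measurableT_comp.
Qed.

Lemma measurable_at_time : measurable_fun setT
  ((fun w => at_time X (s w) w) : Omega -> borel (opc E)).
Proof.
rewrite [X in measurable_fun _ X](_ : _ = (fun w => shifted_path (0%R, w))).
  by apply: (measurableT_comp measurable_shifted_path); exact: measurable_pair1.
by apply/funext => w; rewrite shifted_pathE// adde0.
Qed.

Let measurable_stopped A : stopped_sigma_field X P s A -> measurable A.
Proof. by move=> [+ _]; rewrite (hunt_sigma_field X_Hunt). Qed.

Lemma strong_markov_transition (A : set Omega) (t : R) (phi : opc E -> \bar R) :
  stopped_sigma_field X P s A -> (0 <= t)%R ->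
  measurable_fun setT (phi : borel (opc E) -> \bar R) -> (forall y, 0 <= phi y) ->
  \int[P x]_(w in A) phi (shifted_path (t, w)) =
  \int[P x]_(w in A) transition phi (at_time X (s w) w, t).
Proof.
move=> sA t0; have mA := measurable_stopped sA.
have mS : measurable_fun setT
    ((fun w => shifted_path (t, w)) : Omega -> borel (opc E)).
  by apply: (measurableT_comp measurable_shifted_path); exact: measurable_pair1.
have mSf (f : borel (opc E) -> \bar R) : measurable_fun setT f ->
    measurable_fun A (fun w => f (shifted_path (t, w))).
  by move=> mf; apply: measurable_funTS; exact: (measurableT_comp mf).
have mT (f : borel (opc E) -> \bar R) : measurable_fun setT f ->
    (forall y, 0 <= f y) ->
    measurable_fun A (fun w => transition f (at_time X (s w) w, t)).
  move=> mf f0; apply: measurable_funTS.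
  apply: (measurableT_comp (measurable_transition mf f0)).
  apply/measurable_fun_pairP; split; last exact: measurable_cst.
  exact: measurable_at_time.
have mK (f : borel (opc E) -> \bar R) : measurable_fun setT f ->
    measurable_fun setT (fun w => f (path (t, w))).
  move=> mf; apply: (measurableT_comp mf).
  by apply: (measurableT_comp measurable_joint_path); exact: measurable_pair1.
have T0 f y : (forall y, 0 <= f y) -> 0 <= transition f (y, t).
  by move=> f0; exact: integral_ge0.
move: phi.
refine (@ge0_measurable_ind _ (borel (opc E)) R (fun phi =>
  \int[P x]_(w in A) phi (shifted_path (t, w)) =
  \int[P x]_(w in A) transition phi (at_time X (s w) w, t)) _ _ _ _).
- move=> G mG.
  have := hunt_strong_markov X_Hunt (is_law_dirac X_Hunt x) hs t0 sA mG.
  have mpre : measurable ((fun w => shifted_path (t, w)) @^-1` G).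
    by rewrite -[X in measurable X]setTI; exact: mS.
  rewrite (_ : _ `&` _ = ((fun w => shifted_path (t, w)) @^-1` G) `&` A); last first.
    by rewrite setIC; congr (_ `&` _); apply/seteqP; split => w /=; rewrite shifted_pathE.
  rewrite -integral_indic// => ->; apply: eq_integral => w _.
  rewrite /transition /=.
  have mpre' : measurable (X t @^-1` G).
    by rewrite -[X in measurable X]setTI; apply: (measurable_path X_Hunt t0).
  rewrite -[X t @^-1` G]setIT -integral_indic//; apply: eq_integral => w' _.
  by rewrite /= killed_pathE.
- move=> k f k0 mf f0 Hf.
  rewrite ge0_integralZl_EFin//; last exact: mSf.
  rewrite Hf -ge0_integralZl_EFin//; last 2 first.
  + by move=> w _; exact: T0.
  + exact: mT.
  apply: eq_integral => w _; rewrite /transition /= ge0_integralZl_EFin//; exact: mK.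
- move=> f g mf f0 mg g0 Hf Hg.
  rewrite (ge0_integralD (P x) mA (fun w _ => f0 _) (mSf f mf)
    (fun w _ => g0 _) (mSf g mg)).
  rewrite Hf Hg -(ge0_integralD (P x) mA (fun w _ => T0 f _ f0) (mT f mf f0)
    (fun w _ => T0 g _ g0) (mT g mg g0)).
  apply: eq_integral => w _; rewrite /transition /= ge0_integralD//; exact: mK.
- move=> f_ mf f0 ndf Hf.
  transitivity (limn (fun n => \int[P x]_(w in A) f_ n (shifted_path (t, w)))).
    apply: (@monotone_convergence _ _ _ (P x) A mA (fun n w => f_ n (shifted_path (t, w)))).
    + by move=> n; exact: mSf.
    + by move=> n w _; exact: f0.
    + by move=> w _; exact: ndf.
  under eq_fun do rewrite Hf.
  rewrite -(@monotone_convergence _ _ _ (P x) A mA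
    (fun n w => transition (f_ n) (at_time X (s w) w, t))).
  + apply: eq_integral => w _; rewrite /transition /=; apply/esym.
    apply: (@monotone_convergence _ _ _ (P (at_time X (s w) w)) setT measurableT
      (fun n w' => f_ n (path (t, w')))).
    * by move=> n; exact: mK.
    * by move=> n w' _; exact: f0.
    * by move=> w' _; exact: ndf.
  + by move=> n; exact: mT.
  + by move=> n w _; exact: T0.
  + move=> w _ m n mn; apply: ge0_le_integral => //; [exact: mK|exact: mK|].
    by move=> w' _; exact: (ndf _ _ _ mn).
Qed.

Section resolvent.
Variables (a : R) (phi : opc E -> \bar R).
Hypothesis a_gt0 : (0 < a)%R.
Hypothesis mphi : measurable_fun setT (phi : borel (opc E) -> \bar R).
Hypothesis phi0 : forall y, 0 <= phi y.

Let mshift : measurable_fun setT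
  (fun p : Omega * measurableTypeR R => discount a p.2 * phi (shifted_path (p.2, p.1))).
Proof.
apply: emeasurable_funM.
  by apply: measurableT_comp => //; exact: measurable_discount.
apply: (measurableT_comp mphi); apply: (measurableT_comp measurable_shifted_path).
by apply/measurable_fun_pairP; split => /=; [exact: measurable_snd|exact: measurable_fst].
Qed.

Let future w := \int[lambda]_t (discount a t * phi (shifted_path (t, w))).

Let measurable_future : measurable_fun setT future.
Proof.
apply: (measurable_fun_fubini_tonelli_F
  (fun p : Omega * measurableTypeR R => discount a p.2 * phi (shifted_path (p.2, p.1)))) => //.
by move=> p; rewrite mule_ge0// discount_ge0.
Qed.

Let future_ge0 w : 0 <= future w.
Proof. by apply: integral_ge0 => t _; rewrite mule_ge0// discount_ge0. Qed.

Let measurable_stopped_resolvent :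
  measurable_fun setT (fun w => resolvent_opc a phi (at_time X (s w) w)).
Proof.
exact: (measurableT_comp (measurable_resolvent_opc mphi phi0 a) measurable_at_time).
Qed.

(** Tonelli on both sides reduces the identity to each fixed later time. *)
Lemma strong_markov_future (A : set Omega) : stopped_sigma_field X P s A ->
  \int[P x]_(w in A) future w =
  \int[P x]_(w in A) resolvent_opc a phi (at_time X (s w) w).
Proof.
move=> sA; have mA := measurable_stopped sA.
have mTr : measurable_fun setT (fun p : Omega * measurableTypeR R =>
    discount a p.2 * transition phi (at_time X (s p.1) p.1, p.2)).
  apply: emeasurable_funM.
    by apply: measurableT_comp => //; exact: measurable_discount.
  apply: (measurableT_comp (measurable_transition mphi phi0)).
  apply/measurable_fun_pairP; split => /=; last exact: measurable_snd.
  exact: (measurableT_comp measurable_at_time measurable_fst).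
have Tr0 p : 0 <= transition phi p by exact: integral_ge0.
have swap (f : Omega * measurableTypeR R -> \bar R) : measurable_fun setT f ->
    (forall p, 0 <= f p) ->
    \int[P x]_(w in A) \int[lambda]_t f (w, t) =
    \int[lambda]_t \int[P x]_(w in A) f (w, t).
  move=> mf f0.
  pose g (p : Omega * measurableTypeR R) := if p.1 \in A then f p else 0.
  have mg : measurable_fun setT g.
    apply: measurable_fun_ifT => //.
    apply: (measurable_fun_bool true); rewrite setTI.
    rewrite (_ : _ @^-1` _ = fst @^-1` A); last first.
      by apply/seteqP; split => p /=; [exact: set_mem|exact: mem_set].
    by rewrite -[X in measurable X]setTI; exact: measurable_fst.
  have g0 p : 0 <= g p by rewrite /g; case: ifP.
  rewrite integral_mkcond.
  transitivity (\int[P x]_w \int[lambda]_t g (w, t)).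
    apply: eq_integral => w _; rewrite /patch /g /=; case: ifP => // _.
    by rewrite integral0.
  rewrite (fubini_tonelli g mg g0); apply: eq_integral => t _.
  by rewrite [RHS]integral_mkcond; apply: eq_integral => w _; rewrite /patch /g.
transitivity (\int[lambda]_t \int[P x]_(w in A) (discount a t * phi (shifted_path (t, w)))).
  apply: (swap (fun p => discount a p.2 * phi (shifted_path (p.2, p.1)))) => //.
  by move=> p; rewrite mule_ge0// discount_ge0.
transitivity (\int[lambda]_t \int[P x]_(w in A)
    (discount a t * transition phi (at_time X (s w) w, t))).
  apply: eq_integral => t _.
  have [t0|t0] := leP 0%R t; last first.
    by rewrite /discount leNgt t0 /=; under eq_integral do rewrite mul0e;
      under [RHS]eq_integral do rewrite mul0e.
  rewrite ge0_integralZl ?discount_ge0//; last first.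
    apply: measurable_funTS; apply: (measurableT_comp mphi).
    by apply: (measurableT_comp measurable_shifted_path); exact: measurable_pair1.
  rewrite strong_markov_transition// ge0_integralZl ?discount_ge0//.
  apply: measurable_funTS; apply: (measurableT_comp (measurable_transition mphi phi0)).
  apply/measurable_fun_pairP; split; last exact: measurable_cst.
  exact: measurable_at_time.
rewrite -(swap (fun p => discount a p.2 * transition phi (at_time X (s p.1) p.1, p.2)))//.
  by apply: eq_integral => w _; rewrite resolvent_opcE.
by move=> p; rewrite mule_ge0// discount_ge0.
Qed.

Let tail_future w :
  \int[lambda]_t (if s w <= t%:E then discount a t * phi (path (t, w)) else 0) =
  discount_at a s w * future w.
Proof.
have mpath : measurable_fun setT (fun t : measurableTypeR R => phi (path (t, w))).
  apply: (measurableT_comp mphi).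
  by apply: (measurableT_comp measurable_joint_path); exact: measurable_pair2.
rewrite /discount_at.
case sw : (s w) (s0 w) => [r| |]//; last first.
  by move=> _; rewrite mul0e integral0_eq// => t _.
rewrite lee_fin => r0.
rewrite -(@integral_lebesgue_translation _ r); last 2 first.
- apply: measurable_fun_ifT => //.
    by apply: measurable_fun_lee => //; exact/measurable_EFinP.
  by apply: emeasurable_funM => //; exact: measurable_discount.
- by move=> t; case: ifP => // _; rewrite mule_ge0// discount_ge0.
rewrite /future -ge0_integralZl_EFin ?expR_ge0//; last 2 first.
- by move=> t _; rewrite mule_ge0// discount_ge0.
- apply: emeasurable_funM; first exact: measurable_discount.
  apply: (measurableT_comp mphi).
  by apply: (measurableT_comp measurable_shifted_path); exact: measurable_pair2.
apply: eq_integral => t _; rewrite lee_fin lerDl.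
have [t0|t0] := leP 0%R t; last by rewrite /discount leNgt t0 /= mul0e mule0.
rewrite discountD// -muleA; congr (_ * (_ * phi _)).
by rewrite /shifted_path /= t0 sw ltry.
Qed.

(** Substituting [s + t] for the time extracts the factor [discount_at]. Equality is then needed
    only on the events that [s] is at most [r], which belong to the stopped sigma-field. *)
Lemma strong_markov_resolvent :
  \int[P x]_w \int[lambda]_t (if s w <= t%:E then discount a t * phi (path (t, w)) else 0) =
  \int[P x]_w (discount_at a s w * resolvent_opc a phi (at_time X (s w) w)).
Proof.
under eq_integral do rewrite tail_future.
apply: discounted_integral_eq => //.
- by move=> w; exact: resolvent_opc_ge0.
- move=> r r0; apply: strong_markov_future.
  exact: (stopping_time_le_stopped r0 hs).
Qed.

End resolvent.
End stopping.
End StrongMarkov.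

(** * Null sets *)

Lemma ge0_ae_integral0 d1 d2 (T1 : measurableType d1) (T2 : measurableType d2)
    (R : realType) (m1 : {sigma_finite_measure set T1 -> \bar R})
    (m2 : {sigma_finite_measure set T2 -> \bar R}) (f : T1 * T2 -> \bar R) :
  measurable_fun setT f -> (forall p, 0 <= f p)%E ->
  (forall y, {ae m1, forall x, f (x, y) = 0%E}) ->
  {ae m1, forall x, (\int[m2]_y f (x, y))%E = 0%E}.
Proof.
move=> mf f0 fy.
have : (\int[m1]_x \int[m2]_y f (x, y) = 0)%E.
  rewrite fubini_tonelli// integral0_eq// => y _.
  rewrite (ae_eq_integral (cst 0%E))//; first exact: integral0.
    by apply: (measurableT_comp mf); exact: measurable_pair2.
  by apply: filterS (fy y) => x /= -> _.
have mF := measurable_fun_fubini_tonelli_F (m2 := m2) f mf f0.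
rewrite (_ : (\int[m1]_x _ = _)%E = (\int[m1]_x `|\int[m2]_y f (x, y)| = 0)%E).
  move=> /(ae_eq_integral_abs m1 measurableT mF).
  by apply: filterS => x /(_ I).
congr (_ = _); apply: eq_integral => x _; rewrite gee0_abs//.
exact: integral_ge0.
Qed.

Section SigmaFinite.
Context {R : realType} {E : pmetricType R}.
Hypothesis E_locally_compact : locally_compact [set: E].
Hypothesis E_separable : separable E.
Variable m : {measure set (borel E) -> \bar R}.
Hypothesis m_radon : radon_full_support m.

Lemma radon_sigma_finite : sigma_finite setT m.
Proof.
have [K [cK _ Knbhs]] :=
  compact_nbhs_exhaustion E_locally_compact E_separable (@openT E).
exists K.
  apply/seteqP; split => // x _; have [j /nbhs_singleton Kx] := Knbhs x I.
  by exists j.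
move=> i; split; last by case: m_radon => + _; exact.
have cl : closed (K i) by apply: compact_closed (cK i); exact: metric_hausdorff.
rewrite -(setCK (K i)); apply: measurableC; apply: measurable_generator.
exact: closed_openC.
Qed.

(** A named copy of [m], to which the sigma-finiteness just derived can be attached. *)
Definition radon_measure : set (borel E) -> \bar R := m.

HB.instance Definition _ := Measure.copy radon_measure m.

HB.instance Definition _ :=
  Measure_isSigmaFinite.Build _ _ _ radon_measure radon_sigma_finite.

Lemma ge0_ae_integral0_radon d2 (T2 : measurableType d2)
    (m2 : {sigma_finite_measure set T2 -> \bar R}) (f : borel E * T2 -> \bar R) :
  measurable_fun setT f -> (forall p, 0 <= f p)%E ->
  (forall y, {ae m, forall x, f (x, y) = 0%E}) ->
  {ae m, forall x, (\int[m2]_y f (x, y))%E = 0%E}.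
Proof. exact: (@ge0_ae_integral0 _ _ _ _ _ radon_measure m2). Qed.

End SigmaFinite.

Section NullSets.
Context {R : realType} {E : pmetricType R}.
Variable m : {measure set (borel E) -> \bar R}.

Lemma L2dot_eq0 (v : E -> R) : L2 m v -> L2dot m v v = 0 -> aeeq m v (fun=> 0).
Proof.
move=> L2v; have /Lfun1_integrable vv := Lfun2_mul_Lfun1 L2v L2v.
have fin : (\int[m]_x ((v \* v) x)%:E)%E \is a fin_num by exact: integrable_fin_num vv.
rewrite /L2dot /Rintegral => v0.
have int0 : (\int[m]_x ((v \* v) x)%:E)%E = 0%E by rewrite -(fineK fin) v0.
have mvv : measurable_fun setT (fun x : borel E => ((v \* v) x)%:E).
  exact: measurable_int vv.
have /(ae_eq_integral_abs m measurableT mvv) : (\int[m]_x `|((v \* v) x)%:E| = 0)%E.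
  rewrite -[RHS]int0; apply: eq_integral => x _.
  by rewrite gee0_abs// lee_fin /= -expr2 sqr_ge0.
apply: filterS => x /(_ I) /= [] /eqP; rewrite mulf_eq0 orbb => /eqP.
by [].
Qed.

Lemma L2_indic_null (N : set (borel E)) : measurable N -> m N = 0%E ->
  L2 m (\1_N) /\ L2dot m (\1_N) (\1_N) = 0.
Proof.
move=> mN N0.
have ae0 : {ae m, forall x : borel E, (\1_N x : R) = 0}.
  exists N; split => // x /= /eqP; rewrite indicE.
  by case: (boolP (x \in N)) => [/set_mem//|_]; rewrite eqxx.
split.
  rewrite /L2 /=; apply/andP; split; rewrite inE /=; first exact: measurable_indic.
  rewrite /finite_norm unlock /=.
  rewrite (ae_eq_integral (cst 0%E))//.
  - by rewrite integral0 poweR0r// ltry.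
  - apply/measurable_EFinP.
    apply: (@measurableT_comp _ _ _ _ _ _ (@powR R ^~ 2)) => //.
    by apply: measurableT_comp => //; exact: measurable_indic.
  - apply: filterS ae0 => x -> _ /=; rewrite normr0 powR0//.
rewrite /L2dot /Rintegral (ae_eq_integral (cst 0%E))//.
- by rewrite integral0.
- by apply/measurable_EFinP; apply: measurable_funM; exact: measurable_indic.
- by apply: filterS ae0 => x -> _ /=; rewrite mulr0.
Qed.

Section process.
Hypothesis E_locally_compact : locally_compact [set: E].
Hypothesis E_separable : separable E.
Hypothesis m_radon : radon_full_support m.
Context {d : measure_display} {Omega : measurableType d}.
Variables (X : R -> Omega -> opc E) (P : opc E -> probability Omega R).
Hypothesis X_Hunt : Hunt_process X P.
Variables (alpha0 : R) (D : set (E -> R)) (F : (E -> R) -> (E -> R) -> R).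
Hypothesis X_assoc : associated m alpha0 D F X P.

(** The indicator of [N] has norm zero in L^2, so by the norm bound its image under the semigroup
    vanishes almost everywhere; association transfers this to the process. *)
Lemma transition_null (N : set (borel E)) (t : R) : measurable N -> m N = 0%E ->
  0 <= t ->
  {ae m, forall x : borel E,
     transition X P (ext0 (fun y => (\1_N y)%:E)) (Some x, t) = 0%E}.
Proof.
move=> mN N0 t0; have [T [Tsg TP]] := X_assoc.
have [L2N dot0] := L2_indic_null mN N0.
have T0 : aeeq m (T t (\1_N)) (fun=> 0).
  apply: L2dot_eq0; first exact: (fsg_L2 Tsg).
  apply/eqP; rewrite eq_le; apply/andP; split.
    by have := fsg_bound Tsg t0 L2N; rewrite dot0 mulr0.
  by rewrite /L2dot Rintegral_ge0// => x _; rewrite -expr2 sqr_ge0.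
apply: filterS2 (TP t _ t0 L2N) T0 => x e1 e2.
rewrite /transition /=; under eq_integral do rewrite killed_pathE//.
rewrite -[RHS]/(0%:E) -e2 -e1; apply: eq_integral => w _.
by case: (X t w).
Qed.

(** The exceptional set in [transition_null] varies with [t], over uncountably many times. Tonelli,
    available since [m] is sigma-finite, exchanges the two quantifiers. *)
Lemma resolvent_null (N : set (borel E)) (a : R) : measurable N -> m N = 0%E ->
  {ae m, forall x : borel E,
     resolvent_opc X P a (ext0 (fun y => (\1_N y)%:E)) (Some x) = 0%E}.
Proof.
move=> mN N0; set phi := ext0 _.
have mphi : measurable_fun setT (phi : borel (opc E) -> \bar R).
  by apply: measurable_fun_ext0; apply/measurable_EFinP; exact: measurable_indic.
have phi0 y : (0 <= phi y)%E by case: y => [y|]//=; rewrite lee_fin.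
pose f (p : borel E * measurableTypeR R) : \bar R :=
  (discount a p.2 * transition X P phi (Some p.1, p.2))%E.
have mf : measurable_fun setT f.
  apply: emeasurable_funM.
    by apply: measurableT_comp => //; exact: measurable_discount.
  apply: (measurableT_comp (measurable_transition E_locally_compact E_separable
    X_Hunt mphi phi0)).
  apply/measurable_fun_pairP; split; last exact: measurable_snd.
  exact: (measurableT_comp measurable_fun_Some measurable_fst).
have f0 p : (0 <= f p)%E.
  by rewrite /f mule_ge0 ?discount_ge0//; exact: integral_ge0.
have := @ge0_ae_integral0_radon _ _ E_locally_compact E_separable m m_radon _ _
  lebesgue_measure f mf f0.
have fy (t : measurableTypeR R) : {ae m, forall x, f (x, t) = 0%E}.
  have [t0|t0] := leP 0 (t : R); last first.
    by apply: aeW => x; rewrite /f /discount leNgt t0 mul0e.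
  by apply: filterS (transition_null mN N0 t0) => x e; rewrite /f /= e mule0.
move=> /(_ fy); apply: filterS => x fx.
by rewrite (resolvent_opcE E_locally_compact E_separable X_Hunt mphi phi0).
Qed.

End process.
End NullSets.

(** * Convergence of resolvents *)

Section RealLimits.
Context {R : realType}.
Implicit Types u v : (\bar R)^nat.

Definition cvgn_real u : Prop := exists l : R, u @ \oo --> l%:E.

Lemma cvgn_realP u : cvgn_real u <-> cvgn u /\ limn u \is a fin_num.
Proof.
split=> [[l ul]|[ul fl]].
  by split; [apply/cvg_ex; exists l%:E|rewrite (cvg_lim _ ul)].
by exists (fine (limn u)); rewrite fineK.
Qed.

(** A Cauchy argument: [u] is eventually within [e] of the limit of its approximant for [e / 2]. *)
Lemma cvgn_real_approx u : (forall n, u n \is a fin_num) ->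
  (forall e : R, 0 < e -> exists v, [/\ cvgn_real v, forall n, v n \is a fin_num &
     forall n, (v n <= u n <= v n + e%:E)%E]) ->
  cvgn_real u.
Proof.
move=> fu huv.
have cu : cvgn (fine \o u).
  apply: cauchy_cvg; apply: cauchy_exP => e e0.
  have e20 : 0 < e / 2 by rewrite divr_gt0.
  have [v [[l vl] fv vu]] := huv _ e20.
  exists l; have /fine_cvgP[_ /cvgrPdist_lt/(_ _ e20)] := vl.
  apply: filterS => n /= hn; rewrite /ball /=.
  have := vu n; rewrite -(fineK (fv n)) -(fineK (fu n)) -EFinD !lee_fin => /andP[h1 h2].
  rewrite (splitr e); apply: (le_lt_trans (ler_distD (fine (v n)) _ _)).
  apply: ltr_leD => //; rewrite distrC ger0_norm ?subr_ge0//.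
  by rewrite lerBlDl.
have /cvg_ex[l ul] := cu; exists l.
rewrite (_ : u = EFin \o (fine \o u)); last first.
  by apply/funext => n /=; rewrite fineK.
exact: cvg_EFin (nearW _ _) _.
Qed.

Lemma cvgn_realB u v : cvgn_real u -> cvgn_real v ->
  cvgn_real (fun n => u n - v n)%E.
Proof.
by move=> [l ul] [k vk]; exists (l - k); rewrite EFinB; exact: cvgeB.
Qed.

End RealLimits.

Lemma dominated_cvgn_real d (T : measurableType d) (R : realType)
    (mu : {measure set T -> \bar R}) (f_ : (T -> \bar R)^nat) (g : T -> \bar R) :
  (forall n, measurable_fun setT (f_ n)) -> mu.-integrable setT g ->
  (forall n x, 0 <= f_ n x <= g x)%E ->
  {ae mu, forall x, cvgn_real (f_ ^~ x)} ->
  cvgn_real (fun n => \int[mu]_x f_ n x)%E.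
Proof.
move=> mf ig fg cf.
(* The limit exists only almost everywhere; the upper limit is a measurable substitute defined
   everywhere. *)
have mF : measurable_fun setT (fun x => limn_esup (f_ ^~ x)).
  exact: measurable_fun_limn_esup.
have cF : {ae mu, forall x, setT x -> f_ ^~ x @ \oo --> limn_esup (f_ ^~ x)}.
  apply: filterS cf => x [l fl] _; rewrite is_cvg_limn_esupE; last first.
    by apply/cvg_ex; exists l%:E.
  by rewrite (cvg_lim _ fl).
have bF : {ae mu, forall x n, setT x -> (`|f_ n x| <= g x)%E}.
  by apply: aeW => x n _; have /andP[f0 fgx] := fg n x; rewrite gee0_abs.
have [iF _ cI] := dominated_convergence measurableT mf mF cF ig bF.
exists (fine (\int[mu]_x limn_esup (f_ ^~ x))%E); rewrite fineK//.
exact: integrable_fin_num.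
Qed.

(** * Resolvents before and after a stopping time *)

Section Stopped.
Context {R : realType} {E : pmetricType R}.
Hypothesis E_locally_compact : locally_compact [set: E].
Hypothesis E_separable : separable E.
Context {d : measure_display} {Omega : measurableType d}.
Variables (X : R -> Omega -> opc E) (P : opc E -> probability Omega R).
Hypothesis X_Hunt : Hunt_process X P.
Local Open Scope ereal_scope.
Notation lambda := (@lebesgue_measure R).
Notation path := (killed_path X +oo).
Variable a : R.
Hypothesis a_gt0 : (0 < a)%R.

Definition resolvent_after (s : Omega -> \bar R) (phi : opc E -> \bar R) (y : opc E) :=
  \int[P y]_w \int[lambda]_t (if s w <= t%:E then discount a t * phi (path (t, w)) else 0).

(** For [s] the debut of the complement of [B] and [phi] vanishing at [None], this is the resolvent
    of the part on [B]. *)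
Definition resolvent_before (s : Omega -> \bar R) (phi : opc E -> \bar R) (y : opc E) :=
  \int[P y]_w \int[lambda]_t (if t%:E < s w then discount a t * phi (path (t, w)) else 0).

Section one_function.
Variables (s : Omega -> \bar R) (phi : opc E -> \bar R).
Hypothesis ms : measurable_fun setT s.
Hypothesis mphi : measurable_fun setT (phi : borel (opc E) -> \bar R).
Hypothesis phi0 : forall y, 0 <= phi y.

Let mf : measurable_fun setT (fun p : Omega * measurableTypeR R =>
  discount a p.2 * phi (path (p.2, p.1))).
Proof.
have := measurable_discounted_path E_locally_compact E_separable X_Hunt mphi a.
move=> h; apply: (measurableT_comp h); apply/measurable_fun_pairP.
by split; [exact: measurable_snd|exact: measurable_fst].
Qed.

Let measurable_before : measurable_fun setT (fun p : Omega * measurableTypeR R =>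
  if p.2%:E < s p.1 then discount a p.2 * phi (path (p.2, p.1)) else 0).
Proof.
apply: measurable_fun_ifT => //; apply: measurable_fun_lte; last first.
  exact: measurableT_comp.
by apply/measurable_EFinP; exact: measurable_snd.
Qed.

Let measurable_after : measurable_fun setT (fun p : Omega * measurableTypeR R =>
  if s p.1 <= p.2%:E then discount a p.2 * phi (path (p.2, p.1)) else 0).
Proof.
apply: measurable_fun_ifT => //; apply: measurable_fun_lee.
  exact: measurableT_comp.
by apply/measurable_EFinP; exact: measurable_snd.
Qed.

Let f0 t w : 0 <= discount a t * phi (path (t, w)).
Proof. by rewrite mule_ge0// discount_ge0. Qed.

Lemma resolvent_split y : resolvent_opc X P a phi y =
  resolvent_before s phi y + resolvent_after s phi y.
Proof.
have b0 w t : 0 <= if t%:E < s w then discount a t * phi (path (t, w)) else 0.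
  by case: ifP.
have a0 w t : 0 <= if s w <= t%:E then discount a t * phi (path (t, w)) else 0.
  by case: ifP.
rewrite /resolvent_before /resolvent_after -ge0_integralD//.
- apply: eq_integral => w _; rewrite -ge0_integralD//.
  + by apply: eq_integral => t _; rewrite leNgt; case: ifP; rewrite ?adde0 ?add0e.
  + exact: (measurableT_comp measurable_before (measurable_pair1 w)).
  + exact: (measurableT_comp measurable_after (measurable_pair1 w)).
- by move=> w _; exact: integral_ge0.
- by apply: (measurable_fun_fubini_tonelli_F _ measurable_before) => -[].
- by move=> w _; exact: integral_ge0.
- by apply: (measurable_fun_fubini_tonelli_F _ measurable_after) => -[].
Qed.

Lemma resolvent_before_ge0 y : 0 <= resolvent_before s phi y.
Proof. by apply: integral_ge0 => w _; apply: integral_ge0 => t _; case: ifP. Qed.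

Lemma resolvent_after_ge0 y : 0 <= resolvent_after s phi y.
Proof. by apply: integral_ge0 => w _; apply: integral_ge0 => t _; case: ifP. Qed.

Lemma resolvent_after_le y : resolvent_after s phi y <= resolvent_opc X P a phi y.
Proof. by rewrite resolvent_split leeDr// resolvent_before_ge0. Qed.

Lemma le_resolvent_before (psi : opc E -> \bar R) y :
  measurable_fun setT (psi : borel (opc E) -> \bar R) ->
  (forall z, 0 <= psi z <= phi z) ->
  resolvent_before s psi y <= resolvent_before s phi y.
Proof.
move=> mpsi psi_phi; have psi0 z : 0 <= psi z by case/andP: (psi_phi z).
have mg : measurable_fun setT (fun p : Omega * measurableTypeR R =>
    if p.2%:E < s p.1 then discount a p.2 * psi (path (p.2, p.1)) else 0).
  apply: measurable_fun_ifT => //.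
    apply: measurable_fun_lte; last exact: measurableT_comp.
    by apply/measurable_EFinP; exact: measurable_snd.
  have := measurable_discounted_path E_locally_compact E_separable X_Hunt mpsi a.
  move=> h; apply: (measurableT_comp h); apply/measurable_fun_pairP.
  by split; [exact: measurable_snd|exact: measurable_fst].
have g0 w t : 0 <= if t%:E < s w then discount a t * psi (path (t, w)) else 0.
  by case: ifP => // _; rewrite mule_ge0// discount_ge0.
apply: ge0_le_integral => //.
- by move=> w _; exact: integral_ge0.
- by apply: (measurable_fun_fubini_tonelli_F _ mg) => -[].
- by apply: (measurable_fun_fubini_tonelli_F _ measurable_before) => -[w t] /=; case: ifP.
move=> w _; apply: ge0_le_integral => //.
- exact: (measurableT_comp mg (measurable_pair1 w)).
- exact: (measurableT_comp measurable_before (measurable_pair1 w)).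
move=> t _; case: ifP => // _.
by apply: lee_wpmul2l; [exact: discount_ge0|case/andP: (psi_phi (path (t, w)))].
Qed.

End one_function.

Lemma resolvent_before_cst (r : R) (phi : opc E -> \bar R) y :
  measurable_fun setT (phi : borel (opc E) -> \bar R) -> (forall y, 0 <= phi y) ->
  resolvent_before (fun=> r%:E) phi y =
  \int[lambda]_t (if (t < r)%R then discount a t * transition X P phi (y, t) else 0).
Proof.
move=> mphi phi0.
have mf := measurable_discounted_path E_locally_compact E_separable X_Hunt mphi a.
pose f (p : Omega * measurableTypeR R) := if (p.2 < r)%R then
  discount a p.2 * phi (path (p.2, p.1)) else 0.
have mf' : measurable_fun setT f.
  apply: measurable_fun_ifT => //.
    by apply: measurable_fun_ltr => //; exact: measurable_snd.
  apply: (measurableT_comp mf); apply/measurable_fun_pairP.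
  by split; [exact: measurable_snd|exact: measurable_fst].
have f0 p : 0 <= f p.
  by rewrite /f; case: ifP => // _; rewrite mule_ge0// discount_ge0.
transitivity (\int[lambda]_t \int[P y]_w f (w, t)).
  by rewrite -fubini_tonelli.
apply: eq_integral => t _; rewrite /f /=; case: ifP => _; last by rewrite integral0.
rewrite ge0_integralZl ?discount_ge0//.
apply: (measurableT_comp mphi).
exact: (measurableT_comp (measurable_joint_path E_locally_compact E_separable X_Hunt)
  (measurable_pair1 t)).
Qed.

Lemma le_resolvent_opc (phi psi : opc E -> \bar R) y :
  measurable_fun setT (phi : borel (opc E) -> \bar R) ->
  measurable_fun setT (psi : borel (opc E) -> \bar R) ->
  (forall z, 0 <= psi z <= phi z) ->
  resolvent_opc X P a psi y <= resolvent_opc X P a phi y.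
Proof.
move=> mphi mpsi psi_phi.
have phi0 z : 0 <= phi z by case/andP: (psi_phi z) => ? /(le_trans _); exact.
have beforeE f : resolvent_opc X P a f y = resolvent_before (fun=> +oo) f y.
  by apply: eq_integral => w _; apply: eq_integral => t _; rewrite ltry.
by rewrite !beforeE; apply: le_resolvent_before.
Qed.

Section Domination.
Variables (phi_ : nat -> opc E -> \bar R) (gamma : opc E -> \bar R).
Variable N : set (borel (opc E)).
Hypothesis mphi : forall n, measurable_fun setT (phi_ n : borel (opc E) -> \bar R).
Hypothesis mgamma : measurable_fun setT (gamma : borel (opc E) -> \bar R).
Hypothesis phi_gamma : forall n y, 0 <= phi_ n y <= gamma y.
Hypothesis mN : measurable N.
Hypothesis cvg_off_N : forall y, ~ N y ->
  cvgn_real (fun n => resolvent_opc X P a (phi_ n) y).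

Let ind (y : opc E) : \bar R := (\1_N y)%:E.

Let phi0 n y : 0 <= phi_ n y. Proof. by case/andP: (phi_gamma n y). Qed.

Let gamma0 y : 0 <= gamma y.
Proof. by case/andP: (phi_gamma 0%N y) => ? /(le_trans _); exact. Qed.

Let mind : measurable_fun setT (ind : borel (opc E) -> \bar R).
Proof. by apply/measurable_EFinP; exact: measurable_indic. Qed.

Let ind0 y : 0 <= ind y. Proof. by rewrite lee_fin. Qed.

Definition good_point (y : opc E) : Prop :=
  resolvent_opc X P a gamma y < +oo /\ resolvent_opc X P a ind y = 0.

Let afterE (s : Omega -> \bar R) x (hs : stopping_time X P s) (phi : opc E -> \bar R) :
  measurable_fun setT (phi : borel (opc E) -> \bar R) -> (forall y, 0 <= phi y) ->
  resolvent_after s phi x =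
  \int[P x]_w (discount_at a s w * resolvent_opc X P a phi (at_time X (s w) w)).
Proof.
move=> mp p0.
exact: (strong_markov_resolvent E_locally_compact E_separable X_Hunt x hs a_gt0 mp p0).
Qed.

Let measurable_stopped (s : Omega -> \bar R) (hs : stopping_time X P s)
    (phi : opc E -> \bar R) :
  measurable_fun setT (phi : borel (opc E) -> \bar R) -> (forall y, 0 <= phi y) ->
  measurable_fun setT
    (fun w => discount_at a s w * resolvent_opc X P a phi (at_time X (s w) w)).
Proof.
move=> mp p0; have ms := stopping_time_measurable X_Hunt hs.
apply: emeasurable_funM.
  by apply: measurable_discount_at => //; case: hs.
exact: (measurableT_comp
  (measurable_resolvent_opc E_locally_compact E_separable X_Hunt mp p0 a)
  (measurable_at_time E_locally_compact E_separable X_Hunt hs)).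
Qed.

Let stopped_ge0 (s : Omega -> \bar R) (phi : opc E -> \bar R) w :
  (forall y, 0 <= phi y) ->
  0 <= discount_at a s w * resolvent_opc X P a phi (at_time X (s w) w).
Proof.
by move=> p0; rewrite mule_ge0 ?discount_at_ge0//; exact: resolvent_opc_ge0.
Qed.

(** The integral is [resolvent_after s gamma x], at most the full resolvent; of excessiveness, only
    this inequality is used. *)
Let integrable_stopped s x (hs : stopping_time X P s) :
  resolvent_opc X P a gamma x < +oo -> (P x).-integrable setT
   (fun w => discount_at a s w * resolvent_opc X P a gamma (at_time X (s w) w)).
Proof.
move=> gx; apply/integrableP; split; first exact: measurable_stopped.
under eq_integral do rewrite gee0_abs ?stopped_ge0//.
rewrite -(afterE x hs mgamma gamma0); apply: le_lt_trans gx.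
by apply: resolvent_after_le => //; exact: stopping_time_measurable hs.
Qed.

Lemma stopped_cvgn_real s x : stopping_time X P s ->
  resolvent_opc X P a gamma x < +oo ->
  {ae P x, forall w, s w < +oo ->
     cvgn_real (fun n => resolvent_opc X P a (phi_ n) (at_time X (s w) w))} ->
  cvgn_real (fun n => resolvent_after s (phi_ n) x).
Proof.
move=> hs gx cx.
rewrite (_ : (fun n => _) = (fun n => \int[P x]_w (discount_at a s w *
    resolvent_opc X P a (phi_ n) (at_time X (s w) w)))); last first.
  by apply/funext => n; exact: afterE.
apply: (dominated_cvgn_real (f_ := fun n w => discount_at a s w *
    resolvent_opc X P a (phi_ n) (at_time X (s w) w))) (integrable_stopped hs gx) _ _.
- by move=> n; exact: measurable_stopped.
- move=> n w; apply/andP; split; first exact: stopped_ge0.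
  apply: lee_wpmul2l; first exact: discount_at_ge0.
  exact: le_resolvent_opc.
- apply: filterS cx => w; have [s0 _] := hs.
  rewrite /discount_at; case: (s w) (s0 w) => [r| |]//= r0.
    rewrite ltry => /(_ isT)[l hl]; exists (expR (- (a * r)) * l)%R.
    by rewrite EFinM; exact: cvgeZl.
  by move=> _; exists 0%R; under eq_fun do rewrite mul0e; exact: cvg_cst.
Qed.

(** An integrable function is finite almost surely, and a nonnegative one of integral zero vanishes
    almost surely. Where [s] is finite the discount is positive and can be divided out. *)
Lemma good_point_ae s x : stopping_time X P s -> good_point x ->
  {ae P x, forall w, s w < +oo -> good_point (at_time X (s w) w)}.
Proof.
move=> hs [gx ix]; have [s0 _] := hs.
have ae1 := integrable_ae measurableT (integrable_stopped hs gx).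
have ae2 : {ae P x, forall w,
    discount_at a s w * resolvent_opc X P a ind (at_time X (s w) w) = 0}.
  have int0 : \int[P x]_w
      `|discount_at a s w * resolvent_opc X P a ind (at_time X (s w) w)| = 0.
    under eq_integral do rewrite gee0_abs ?stopped_ge0//.
    rewrite -(afterE x hs mind ind0); apply/eqP; rewrite eq_le resolvent_after_ge0// andbT -ix.
    by apply: resolvent_after_le => //; exact: stopping_time_measurable hs.
  have := ae_eq_integral_abs (P x) measurableT (measurable_stopped hs mind ind0).
  by move=> [/(_ int0) + _]; apply: filterS => w /(_ Logic.I).
apply: filterS2 ae1 ae2 => w /(_ Logic.I).
rewrite /discount_at; case: (s w) (s0 w) => [r| |]// _; set y := at_time X _ w.
have e0 : (0 < expR (- (a * r)))%R by exact: expR_gt0.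
move=> f1 f2 _; split.
  have := resolvent_opc_ge0 X P gamma0 a y.
  move: f1; case: (resolvent_opc X P a gamma y) => [q| |]//=; first by rewrite ltry.
  by rewrite gt0_muley ?lte_fin.
by move/eqP: f2; rewrite mule_eq0 eqe gt_eqF//= => /eqP.
Qed.

Let measurable_discounted_transition (phi : opc E -> \bar R) y :
  measurable_fun setT (phi : borel (opc E) -> \bar R) -> (forall z, 0 <= phi z) ->
  measurable_fun setT
    ((fun t => discount a t * transition X P phi (y, t)) : measurableTypeR R -> \bar R).
Proof.
move=> mp p0; apply: emeasurable_funM; first exact: measurable_discount.
have mt := measurable_transition E_locally_compact E_separable X_Hunt mp p0.
apply: (measurableT_comp mt); apply/measurable_fun_pairP.
by split; [exact: measurable_cst|exact: measurable_id].
Qed.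

Let small_before y (e : R) : resolvent_opc X P a gamma y < +oo -> (0 < e)%R ->
  exists2 r : R, (0 < r)%R &
    \int[lambda]_t (if (t < r)%R then discount a t * transition X P gamma (y, t) else 0)
    < e%:E.
Proof.
rewrite (resolvent_opcE E_locally_compact E_separable X_Hunt mgamma gamma0) => gy e0.
pose rho t := discount a t * transition X P gamma (y, t).
have rho0 t : 0 <= rho t.
  by rewrite mule_ge0 ?discount_ge0//; exact: integral_ge0.
have mrho : measurable_fun setT (rho : measurableTypeR R -> _).
  exact: measurable_discounted_transition.
pose f_ (k : nat) (t : R) := if (t < k.+1%:R^-1)%R then rho t else 0.
have mf_ k : measurable_fun setT (f_ k : measurableTypeR R -> _).
  by apply: measurable_fun_ifT => //; exact: measurable_fun_ltr.
have irho : lambda.-integrable setT (rho : measurableTypeR R -> _).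
  apply/integrableP; split => //.
  by under eq_integral do rewrite gee0_abs//.
have cf_ : {ae lambda, forall t, setT t -> f_ ^~ t @ \oo --> (0 : \bar R)}.
  (* Time [0] must be excluded: it lies in every interval of the sequence, so there the functions do
     not shrink. *)
  exists [set 0%R : measurableTypeR R]; split => //.
  - exact: lebesgue_measure_set1.
  - move=> t /= ht; apply: contrapT => /eqP t0; apply: ht => _.
    have [t1|t1] := ltP t 0%R.
      rewrite (_ : f_ ^~ t = cst 0); first exact: cvg_cst.
      apply/funext => k; rewrite /f_ /rho /discount leNgt t1 /= mul0e.
      by case: ifP.
    have tgt0 : (0 < t)%R by rewrite lt_neqAle eq_sym t0.
    have [n _ hn] := near_infty_natSinv_lt (PosNum tgt0).
    apply: (cvg_near_cst _); exists n => // k /= nk.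
    by rewrite /f_ ltNge ltW//; exact: hn k nk.
have bf_ : {ae lambda, forall t n, setT t -> `|f_ n t| <= rho t}.
  by apply: aeW => t n _; rewrite /f_; case: ifP => _; rewrite ?abse0// gee0_abs.
have [_ _] := dominated_convergence measurableT mf_ (measurable_cst (0 : \bar R)) cf_ irho bf_.
rewrite integral0 => cI.
have /cI[k _ hk] : nbhs (0 : \bar R) [set z | z < e%:E].
  by apply: open_nbhs_nbhs; split; [exact: open_ereal_lt_ereal|rewrite /= lte_fin].
by exists (k.+1%:R^-1)%R; [rewrite invr_gt0|exact: hk k (leqnn k)].
Qed.

(* Started from a good point, the process avoids [N] at almost every time [s], so
   the resolvents converge after time [s]; what happens before a small time [s] is
   uniformly negligible. *)
Lemma good_point_cvgn_real y : good_point y ->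
  cvgn_real (fun n => resolvent_opc X P a (phi_ n) y).
Proof.
move=> [gy iy].
have le_gamma n : resolvent_opc X P a (phi_ n) y <= resolvent_opc X P a gamma y.
  exact: le_resolvent_opc.
have fin n : resolvent_opc X P a (phi_ n) y \is a fin_num.
  rewrite ge0_fin_numE; first exact: le_lt_trans gy.
  exact: resolvent_opc_ge0.
apply: cvgn_real_approx => // e e0.
have [r r0 hr] := small_before gy e0.
have aeind : {ae lambda, forall t, discount a t * transition X P ind (y, t) = 0}.
  have mrho : measurable_fun setT
      ((fun t => discount a t * transition X P ind (y, t)) : measurableTypeR R -> _).
    exact: measurable_discounted_transition.
  have int0 : \int[lambda]_t `|discount a t * transition X P ind (y, t)| = 0.
    rewrite -iy (resolvent_opcE E_locally_compact E_separable X_Hunt mind ind0).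
    apply: eq_integral => t _; rewrite gee0_abs//.
    by rewrite mule_ge0 ?discount_ge0//; exact: integral_ge0.
  have [/(_ int0) + _] := ae_eq_integral_abs lambda measurableT mrho.
  by apply: filterS => t /(_ Logic.I).
(* Otherwise the interval from [0] to [r], of length [r > 0], would be contained in a null set. *)
have [s [s0 sr is0]] : exists s : R, [/\ (0 < s)%R, (s < r)%R &
    transition X P ind (y, s) = 0].
  have [M [mM M0 hM]] := aeind; apply: contrapT => /forallNP ns.
  suff : lambda `]0%R, r[%classic <= 0.
    by rewrite lebesgue_measure_itv/= lte_fin r0 sube0 lee_fin leNgt r0.
  rewrite -M0; apply: le_measure; rewrite ?inE//.
  move=> t /=; rewrite in_itv/= => /andP[t0 tr]; apply: hM => /= ht.
  apply: (ns t); split => //; move/eqP: ht.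
  by rewrite /discount (ltW t0) mule_eq0 eqe gt_eqF ?expR_gt0//= => /eqP.
have hs := stopping_time_cst X P (ltW s0).
exists (fun n => resolvent_after (fun=> s%:E) (phi_ n) y); split.
- apply: stopped_cvgn_real => //.
  have int0 : \int[P y]_w `|ind (path (s, w))| = 0.
    by rewrite -is0; apply: eq_integral => w _; rewrite gee0_abs.
  have mi : measurable_fun setT (fun w => ind (path (s, w))).
    apply: (measurableT_comp mind).
    exact: (measurableT_comp (measurable_joint_path E_locally_compact E_separable
      X_Hunt) (measurable_pair1 s)).
  have [/(_ int0) + _] := ae_eq_integral_abs (P y) measurableT mi.
  apply: filterS => w /(_ Logic.I); rewrite /= killed_pathE ?(ltW s0)// => iw _.
  apply: cvg_off_N => Nw; move: iw; rewrite /ind indicE mem_set//= => /eqP.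
  by rewrite eqe oner_eq0.
- move=> n; rewrite ge0_fin_numE; last exact: resolvent_after_ge0.
  apply: le_lt_trans gy; apply: le_trans (le_gamma n).
  by apply: resolvent_after_le.
(* The error is the part before [s]; it is dominated by the part of [gamma] before [r], which was
   made smaller than [e]. *)
- move=> n; rewrite (resolvent_split (s := fun=> s%:E))// leeDr ?resolvent_before_ge0//=.
  rewrite addeC leeD2l//; apply: le_trans (ltW hr).
  apply: (@le_trans _ _ (resolvent_before (fun=> s%:E) gamma y)).
    exact: le_resolvent_before.
  rewrite resolvent_before_cst//.
  have mtr : measurable_fun setT
      ((fun t => discount a t * transition X P gamma (y, t)) : measurableTypeR R -> _).
    exact: measurable_discounted_transition.
  have tr0 t : 0 <= discount a t * transition X P gamma (y, t).
    by rewrite mule_ge0 ?discount_ge0//; exact: integral_ge0.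
  apply: ge0_le_integral => //.
  + by move=> t _; case: ifP.
  + by apply: measurable_fun_ifT => //; exact: measurable_fun_ltr.
  + by apply: measurable_fun_ifT => //; exact: measurable_fun_ltr.
  + move=> t _; case: ifPn => [ts|_]; first by rewrite (lt_trans ts sr).
    by case: ifP.
Qed.

Lemma resolvent_before_cvgn_real s x : stopping_time X P s -> good_point x ->
  cvgn_real (fun n => resolvent_before s (phi_ n) x).
Proof.
move=> hs gx; have ms := stopping_time_measurable X_Hunt hs.
have cx := good_point_cvgn_real gx.
have ca : cvgn_real (fun n => resolvent_after s (phi_ n) x).
  apply: stopped_cvgn_real => //; first by case: gx.
  by apply: filterS (good_point_ae hs gx) => w h /h; exact: good_point_cvgn_real.
rewrite (_ : (fun n => _) = (fun n => resolvent_opc X P a (phi_ n) x -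
    resolvent_after s (phi_ n) x)); first exact: cvgn_realB.
apply/funext => n; rewrite (resolvent_split ms (mphi n) (phi0 n)) addeK//.
rewrite ge0_fin_numE ?resolvent_after_ge0//.
case: gx => gx _; apply: le_lt_trans gx.
apply: le_trans (resolvent_after_le ms (mphi n) (phi0 n) x) _.
exact: le_resolvent_opc.
Qed.

End Domination.
End Stopped.

(** * The part of the process *)

Section Resolvents.
Context {R : realType} {E : pmetricType R}.
Hypothesis E_locally_compact : locally_compact [set: E].
Hypothesis E_separable : separable E.
Context {d : measure_display} {Omega : measurableType d}.
Variables (X : R -> Omega -> opc E) (P : opc E -> probability Omega R).
Hypothesis X_Hunt : Hunt_process X P.
Local Open Scope ereal_scope.

Lemma resolventE a (f : E -> \bar R) x :
  resolvent P X a f x = resolvent_opc X P a (ext0 f) (Some x).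
Proof.
apply: eq_integral => w _; rewrite integral_mkcond; apply: eq_integral => t _.
rewrite patchE mem_setE in_itv/= andbT /discount.
by case: ifP => t0; rewrite ?mul0e// killed_pathE.
Qed.

Lemma resolvent_partE a (B : set E) (f : E -> \bar R) x :
  resolvent P (part_process X B) a f x =
  resolvent_before X P a (debut_out X B) (ext0 f) (Some x).
Proof.
apply: eq_integral => w _; rewrite integral_mkcond; apply: eq_integral => t _.
rewrite patchE mem_setE in_itv/= andbT /discount /part_process.
case: ifP => t0; last by rewrite mul0e if_same.
by case: ifP => _; rewrite ?mule0// killed_pathE.
Qed.

(** The cemetery is outside the exceptional set [N], so convergence is required there as well; the
    process started there almost surely stays there at each time. *)
Lemma resolvent_opc_None a (phi : opc E -> \bar R) :
  measurable_fun setT (phi : borel (opc E) -> \bar R) -> (forall y, 0 <= phi y) ->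
  phi None = 0 -> resolvent_opc X P a phi None = 0.
Proof.
move=> mphi phi0 phiN; rewrite (resolvent_opcE E_locally_compact E_separable)//.
rewrite integral0_eq// => t _; have [t0|t0] := leP 0%R t; last first.
  by rewrite /discount leNgt t0 mul0e.
rewrite /transition /= (ae_eq_integral (cst 0))//; first by rewrite integral0 mule0.
  apply: (measurableT_comp mphi).
  exact: (measurableT_comp (measurable_joint_path E_locally_compact E_separable X_Hunt)
    (measurable_pair1 t)).
have mT : measurable [set w | X t w = None].
  rewrite -[X in measurable X]setTI.
  exact: (measurable_path X_Hunt t0 measurableT (@measurable_None R E)).
exists (~` [set w | X t w = None]); split; first exact: measurableC.
  transitivity (1 - P None [set w | X t w = None]); first exact: probability_setC.
  by rewrite (hunt_cemetery X_Hunt t0) subee.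
by apply: subsetC => w /= Xt _; rewrite killed_pathE// Xt.
Qed.

Lemma ge_resolvent_opc (a b : R) (phi : opc E -> \bar R) y : (b <= a)%R ->
  measurable_fun setT (phi : borel (opc E) -> \bar R) -> (forall z, 0 <= phi z) ->
  resolvent_opc X P a phi y <= resolvent_opc X P b phi y.
Proof.
move=> ba mphi phi0.
have E_y c := resolvent_opcE E_locally_compact E_separable X_Hunt mphi phi0 c y.
rewrite !E_y.
have tr0 t : 0 <= transition X P phi (y, t) by exact: integral_ge0.
have mt : measurable_fun setT
    ((fun t => transition X P phi (y, t)) : measurableTypeR R -> _).
  have mt := measurable_transition E_locally_compact E_separable X_Hunt mphi phi0.
  apply: (measurableT_comp mt); apply/measurable_fun_pairP.
  by split; [exact: measurable_cst|exact: measurable_id].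
apply: ge0_le_integral => //.
- by move=> t _; rewrite mule_ge0 ?discount_ge0.
- by apply: emeasurable_funM => //; exact: measurable_discount.
- by apply: emeasurable_funM => //; exact: measurable_discount.
move=> t _; apply: lee_wpmul2r => //.
rewrite /discount; case: ifP => // t0.
by rewrite lee_fin ler_expR lerN2 ler_wpM2r.
Qed.

End Resolvents.

Theorem proposition2p8 (R : realType) (E : pmetricType R)
  (E_locally_compact : locally_compact [set: E]) (E_separable : separable E)
  (m : {measure set (borel E) -> \bar R}) (m_radon : radon_full_support m)
  (alpha0 : R) (D : set (E -> R)) (F : (E -> R) -> (E -> R) -> R)
  (F_form : semi_Dirichlet_form m alpha0 D F)
  (F_regular : regular_form m alpha0 D F)
  (d : measure_display) (Omega : measurableType d)
  (X : R -> Omega -> opc E) (P : opc E -> probability Omega R)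
  (X_Hunt : Hunt_process X P) (X_assoc : associated m alpha0 D F X P)
  (Pf : set (E -> \bar R)) (Pf_sub : Pf `<=` Borel_real_nneg)
  (Pf_P1 : P1 Pf) (Pf_P2 : P2 Pf)
  (B : set (borel E)) (B_borel : measurable B) :
  compactness_property m P X Pf ->
  compactness_property m P (part_process X B) (vanishing_off Pf B).
Proof.
move=> cpt u_ u_Pf.
pose g x := ereal_sup (range (u_ ^~ x)).
have gPf : Pf g by apply: Pf_P2 => n; case: (u_Pf n).
have Pf_measurable f : Pf f ->
    measurable_fun setT (ext0 f : borel (opc E) -> \bar R).
  by move=> /Pf_sub[[mf _] _]; exact: measurable_fun_ext0.
have Pf_ge0 f : Pf f -> forall y, (0 <= ext0 f y)%E.
  by move=> /Pf_sub[[_ f0] _] [x|]//=; exact: f0.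
have u_g n y : (0 <= ext0 (u_ n) y <= ext0 g y)%E.
  rewrite (Pf_ge0 _ (u_Pf n).1) /=; case: y => [x|]//=.
  by apply: ereal_sup_ubound; exists n.
have [L [phi [L0 Lsup phi_incr cvgL]]] := cpt u_ (fun n => (u_Pf n).1).
(* Along a constant sequence the limit is the resolvent of [g] itself, which is thereby finite
   almost everywhere at each index of [L']. *)
have [L' [_ [L'0 L'sup _ cvgL']]] := cpt (fun=> g) (fun=> gPf).
have [b L'b] : exists b, L' b.
  have : (0 < ereal_sup [set a%:E | a in L'])%E by rewrite L'sup ltry.
  by move=> /ereal_sup_gt[_ [b L'b _] _]; exists b.
have g_fin : {ae m, forall x : borel E,
    (resolvent_opc X P b (ext0 g) (Some x) < +oo)%E}.
  have [_] := cvgL' b L'b; apply: filterS => x.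
  by rewrite lim_cst// (resolventE X P b g x) fin_numElt => /andP[].
(* Resolvents decrease in the index, so finiteness at [b] persists for [a >= b]; the cut leaves the
   supremum infinite. *)
exists (L `&` [set a | b <= a]), phi; split => //.
- by move=> a [/L0].
- apply/eqyP => A _; have : ((Num.max A b)%:E < ereal_sup [set a%:E | a in L])%E.
    by rewrite Lsup ltry.
  move=> /ereal_sup_gt[_ [a La <-]]; rewrite lte_fin gt_max => /andP[Aa ba].
  apply: (@le_trans _ _ a%:E); first by rewrite lee_fin ltW.
  by apply: ereal_sup_ubound; exists a => //; split => //=; exact: ltW.
move=> a [La /= ba]; have a_gt0 : 0 < a by exact: L0.
have [N [mN N0 cvg_off]] : {ae m, forall x : borel E,
    cvgn_real (fun n => resolvent_opc X P a (ext0 (u_ (phi n))) (Some x))}.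
  have [cv fin] := cvgL a La; apply: filterS2 cv fin => x cx fx.
  have -> : (fun n => resolvent_opc X P a (ext0 (u_ (phi n))) (Some x)) =
      (fun n => resolvent P X a (u_ (phi n)) x).
    by apply/funext => n; rewrite (resolventE X P a (u_ (phi n)) x).
  exact/cvgn_realP.
have mN' : measurable (Some @` N : set (borel (opc E))).
  exact: measurable_Some_image.
have cvg_off' (y : opc E) : ~ (Some @` N) y ->
    cvgn_real (fun n => resolvent_opc X P a (ext0 (u_ (phi n))) y).
  case: y => [x|] ny.
    by apply: contrapT => nx; apply: ny; exists x => //; exact: cvg_off.
  exists 0; rewrite (_ : (fun n => _) = cst 0%E); first exact: cvg_cst.
  apply/funext => n; apply: (resolvent_opc_None E_locally_compact E_separable X_Hunt) => //.
  - exact: Pf_measurable (u_Pf _).1.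
  - exact: Pf_ge0 (u_Pf _).1.
have good_ae : {ae m, forall x : borel E,
    good_point X P a (ext0 g) (Some @` N) (Some x)}.
  have null := resolvent_null E_locally_compact E_separable m_radon X_Hunt X_assoc a mN N0.
  apply: filterS2 g_fin null => x gx nx; split.
    apply: le_lt_trans gx.
    apply: (ge_resolvent_opc E_locally_compact E_separable X_Hunt) => //.
    - exact: Pf_measurable.
    - exact: Pf_ge0.
  rewrite -[RHS]nx; congr (resolvent_opc X P a _ _); apply/funext => -[y|] /=; rewrite indicE.
    have -> : ((Some y : borel (opc E)) \in Some @` N) = (y \in N) :> bool.
      apply/idP/idP => /set_mem h; apply/mem_set; last by exists y.
      by case: h => z Nz [<-].
    by [].
  by rewrite memNset// => -[].
have part_cvg : {ae m, forall x : borel E,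
    cvgn_real (fun n => resolvent P (part_process X B) a (u_ (phi n)) x)}.
  have tau := stopping_time_debut_out E_locally_compact E_separable X_Hunt B_borel.
  apply: filterS good_ae => x gx.
  rewrite (_ : (fun n => _) = (fun n =>
      resolvent_before X P a (debut_out X B) (ext0 (u_ (phi n))) (Some x))); last first.
    by apply/funext => n; exact: (resolvent_partE X P a B (u_ (phi n)) x).
  apply: (resolvent_before_cvgn_real E_locally_compact E_separable X_Hunt a_gt0
    (gamma := ext0 g) (N := Some @` N)) => // [n|].
  - exact: Pf_measurable (u_Pf _).1.
  - exact: Pf_measurable.
by split; apply: filterS part_cvg => x /cvgn_realP[].
Qed.
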